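(* For every positive integer $n$, $$Z_{n}(u_1,\ldots,u_n;u_{n+1})_{\mathrm{OOSASM}} = P_{\lceil n/2 \rceil}(u_1,\ldots,u_{2 \lceil n/2 \rceil}) \; Q_{\lceil (n+1)/2 \rceil}(u_1,\ldots,u_{2 \lceil (n+1)/2 \rceil -1}),$$ where $$P_m(u_1,\ldots,u_{2m}) = \sigma(q^4)^{-(m-1)2m} \prod_{1\le i<j\le2m}\frac{\sigma(q^2u_iu_j)\,\sigma(q^2 \bar u_i \bar u_j)}{\sigma(u_i \bar u_j)}\; \underset{1\le i<j\le2m}{\mathrm{Pf}}\left(\frac{\sigma(u_i \bar u_j)}{\sigma(q^2u_iu_j)\,\sigma(q^2 \bar u_i \bar u_j)}\right)$$ and $$Q_m(u_1,\ldots,u_{2m-1}) = \sigma(q^4)^{-(m-1)(2m-1)} \prod_{1\le i<j\le2m-1}\frac{\sigma(q^2u_iu_j)\,\sigma(q^2 \bar u_i \bar u_j)}{\sigma(u_i \bar u_j)}\; \underset{1\le i<j\le2m}{\mathrm{Pf}} \left( \begin{cases} \frac{\sigma(u_i \bar u_j)}{\sigma(q^2u_iu_j)} + \frac{ \sigma(u_i \bar u_j)}{\sigma(q^2 \bar u_i \bar u_j)}, & j<2m \\ 1, & j=2m \end{cases} \right).$$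
   Context: Here $q,u_1,\dots,u_{n+1}$ are indeterminates; write $\bar x=x^{-1}$ and $\sigma(x)=x-\bar x$. The Pfaffian of a triangular array $(a_{i,j})_{1\le i<j\le 2m}$ is $\sum_\pi \operatorname{sgn}\pi\prod_{k=1}^m a_{i_k,j_k}$, summed over perfect matchings $\pi=\{\{i_1,j_1\},\dots,\{i_m,j_m\}\}$ of $\{1,\dots,2m\}$ with $i_k<j_k$, where $\operatorname{sgn}\pi$ is the sign of the permutation $i_1j_1i_2j_2\cdots i_mj_m$. Graph. Let $\mathcal T_n$ be the graph with vertices $(0,j)$, $1\le j\le 2n+1$, and $(i,j)$, $1\le i\le n+1$, $i\le j\le 2n+2-i$ (matrix coordinates: $i$ increases downwards, $j$ increases to the right). Vertical edges join $(i-1,j)$ and $(i,j)$ whenever both are vertices; horizontal edges join $(i,j)$ and $(i,j+1)$ whenever both are vertices and $i\ge1$. Bulk vertices: $(i,j)$ with $1\le i\le n$, $i<j<2n+2-i$ (degree 4). Left boundary vertices: $(i,i)$, $1\le i\le n$ (one edge going up, one going right). Right boundary vertices: $(i,2n+2-i)$, $1\le i\le n$ (one edge going up, one going left). The remaining vertices have degree 1. A configuration is an orientation of $\mathcal T_n$ such that each bulk vertex has two incoming and two outgoing edges and each top edge is directed upwards (from $(1,j)$ to $(0,j)$). The label of the bulk vertex $(i,j)$ is $u_iu_{\min(j,2n+2-j)}$, and the label of the boundary vertices $(i,i)$ and $(i,2n+2-i)$ is $u_i$. The weight of a configuration is the product of all vertex weights; degree 1 vertices have weight 1, and the other vertices,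 with label $u$, have the following weights. Bulk: weight $1$ if both vertical edges are outgoing or both are incoming; $\sigma(q^2u)/\sigma(q^4)$ if both vertical edges point up and both horizontal edges point right, or both vertical edges point down and both horizontal edges point left; $\sigma(q^2\bar u)/\sigma(q^4)$ if both vertical edges point down and both horizontal edges point right, or both vertical edges point up and both horizontal edges point left. Boundary (OOSASM specialization): a left or right boundary vertex with one incoming and one outgoing edge has weight $0$; a left boundary vertex with both edges incoming or both edges outgoing has weight $\sigma(q^2u^2)/\sigma(q^2)$; a right boundary vertex with both edges incoming or both edges outgoing has weight $\sigma(q^2\bar u^2)/\sigma(q^2)$. $Z_n(u_1,\dots,u_n;u_{n+1})_{\mathrm{OOSASM}}$ is the sum of the weights of all configurations divided by the common factor $\prod_{i=1}^n\frac{\sigma(q^2u_i^2)\,\sigma(q^2\bar u_i^2)}{\sigma(q^2)^2}$ (equivalently, one sums over the configurations in which each boundary vertex has both edges incoming or both outgoing, with all boundary weights equal to $1$). *)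

(* Defs.v *)
From mathcomp Require Import all_boot all_order all_fingroup all_algebra.
From mathcomp Require Import mpoly.

Set Implicit Arguments.
Unset Strict Implicit.
Unset Printing Implicit Defensive.

Import GRing.Theory.
Local Open Scope ring_scope.

(* The indeterminates live in the field of rational functions
   K(X_0, ..., X_(n+1)): q is X_0 and u_i is X_i for 1 <= i <= n+1.  Families
   u_1, u_2, ... are functions on nat, whose value at 0 is never used. *)
Definition indet (K : fieldType) (n k : nat) : {fraction {mpoly K[n.+2]}} :=
  tofrac ('X_(inord k) : {mpoly K[n.+2]}).

Definition sigma (F : fieldType) (x : F) : F := x - x^-1.

(* Grid points (i, j) with 0 <= i <= n+1 and 0 <= j <= 2n+1; not all of them
   are vertices of T_n. *)
Definition grid (n : nat) : finType := ('I_n.+2 * 'I_n.*2.+2)%type.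

Definition pt (n i j : nat) : grid n := (inord i, inord j).

Definition is_vertex (n : nat) (x : grid n) : bool :=
  let i : nat := x.1 in let j : nat := x.2 in
  ((i == 0) && (1 <= j <= n.*2.+1)
   || (1 <= i <= n.+1) && (i <= j <= n.*2.+2 - i))%N.

Definition vedge (n : nat) (x y : grid n) : bool :=
  [&& is_vertex x, is_vertex y, y.1 == x.1.+1 :> nat & y.2 == x.2].

Definition hedge (n : nat) (x y : grid n) : bool :=
  [&& is_vertex x, is_vertex y, (1 <= x.1)%N, y.1 == x.1
    & y.2 == x.2.+1 :> nat].

Definition adjacent (n : nat) (x y : grid n) : bool :=
  [|| vedge x y, vedge y x, hedge x y | hedge y x].

Definition is_bulk (n : nat) (x : grid n) : bool :=
  ((1 <= x.1 <= n) && (x.1 < x.2 < n.*2.+2 - x.1))%N.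

Definition is_left (n : nat) (x : grid n) : bool :=
  ((1 <= x.1 <= n) && (x.2 == x.1 :> nat))%N.

Definition is_right (n : nat) (x : grid n) : bool :=
  ((1 <= x.1 <= n) && (x.2 == n.*2.+2 - x.1 :> nat))%N.

(* An orientation is the set of its arcs (x, y), each directed from x to y. *)
Definition is_orientation (n : nat) (D : {set grid n * grid n}) : bool :=
  [forall x : grid n, forall y : grid n,
    if adjacent x y then ((x, y) \in D) (+) ((y, x) \in D)
    else (x, y) \notin D].

Definition is_config (n : nat) (D : {set grid n * grid n}) : bool :=
  [&& is_orientation D,
      [forall x : grid n, is_bulk x ==>
         (#|[set y | (y, x) \in D]| == 2) && (#|[set y | (x, y) \in D]| == 2)]
    & [forall x : grid n, forall y : grid n,
         vedge x y && (x.1 == 0 :> nat) ==> ((y, x) \in D)]].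

Definition label (F : fieldType) (n : nat) (u : nat -> F) (x : grid n) : F :=
  u x.1 * u (minn x.2 (n.*2.+2 - x.2)).

(* In the weights, a bit oN (resp. oS, oW, oE) says that the edge going up
   (resp. down, left, right) from the vertex is outgoing; otherwise it is
   incoming. *)
Definition bulk_weight (F : fieldType) (q u : F) (oN oS oW oE : bool) : F :=
  if oN == oS then 1
  else if [&& oN, ~~ oS, oE & ~~ oW] || [&& oS, ~~ oN, oW & ~~ oE] then
    sigma (q ^+ 2 * u) / sigma (q ^+ 4)
  else if [&& oS, ~~ oN, oE & ~~ oW] || [&& oN, ~~ oS, oW & ~~ oE] then
    sigma (q ^+ 2 * u^-1) / sigma (q ^+ 4)
  else 0. (* excluded at a bulk vertex of a configuration *)

Definition left_weight (F : fieldType) (q u : F) (oN oE : bool) : F :=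
  if oN == oE then sigma (q ^+ 2 * u ^+ 2) / sigma (q ^+ 2) else 0.

Definition right_weight (F : fieldType) (q u : F) (oN oW : bool) : F :=
  if oN == oW then sigma (q ^+ 2 * u^-1 ^+ 2) / sigma (q ^+ 2) else 0.

Definition vertex_weight (F : fieldType) (n : nat) (q : F) (u : nat -> F)
    (D : {set grid n * grid n}) (x : grid n) : F :=
  let i : nat := x.1 in let j : nat := x.2 in
  let oN := (x, pt n i.-1 j) \in D in
  let oS := (x, pt n i.+1 j) \in D in
  let oW := (x, pt n i j.-1) \in D in
  let oE := (x, pt n i j.+1) \in D in
  if is_bulk x then bulk_weight q (label u x) oN oS oW oE
  else if is_left x then left_weight q (u i) oN oE
  else if is_right x then right_weight q (u i) oN oW
  else 1.

Definition config_weight (F : fieldType) (n : nat) (q : F) (u : nat -> F)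
    (D : {set grid n * grid n}) : F :=
  \prod_(x : grid n | is_vertex x) vertex_weight q u D x.

Definition Z_OOSASM (F : fieldType) (n : nat) (q : F) (u : nat -> F) : F :=
  (\sum_(D : {set grid n * grid n} | is_config D) config_weight q u D)
  / \prod_(1 <= i < n.+1)
      (sigma (q ^+ 2 * u i ^+ 2) * sigma (q ^+ 2 * (u i)^-1 ^+ 2)
       / sigma (q ^+ 2) ^+ 2).

Definition pair_fst (m : nat) (k : 'I_m) : 'I_m.*2 :=
  Ordinal (etrans (ltn_double k m) (ltn_ord k)).

Definition pair_snd (m : nat) (k : 'I_m) : 'I_m.*2 :=
  Ordinal (etrans (ltn_Sdouble k m) (ltn_ord k)).

(* A perfect matching {{i_1, j_1}, ..., {i_m, j_m}} is represented by the
   permutation i_1 j_1 ... i_m j_m with i_k < j_k for all k and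
   i_1 < ... < i_m; exactly one order of the pairs meets the last condition,
   and the sign of the permutation does not depend on that order. *)
Definition is_matching (m : nat) (s : 'S_(m.*2)) : bool :=
  [forall k : 'I_m, (s (pair_fst k) < s (pair_snd k))%N]
  && [forall k : 'I_m, forall l : 'I_m,
        (k < l)%N ==> (s (pair_fst k) < s (pair_fst l))%N].

(* The array a is indexed from 1, whereas 'S_(m.*2) permutes 0, ..., 2m-1. *)
Definition Pf (F : fieldType) (m : nat) (a : nat -> nat -> F) : F :=
  \sum_(s : 'S_(m.*2) | is_matching s)
    (-1) ^+ s * \prod_(k < m) a (s (pair_fst k)).+1 (s (pair_snd k)).+1.

Definition prefactor (F : fieldType) (N : nat) (q : F) (u : nat -> F) : F :=
  \prod_(1 <= i < N.+1) \prod_(i.+1 <= j < N.+1)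
    (sigma (q ^+ 2 * u i * u j) * sigma (q ^+ 2 * (u i)^-1 * (u j)^-1)
     / sigma (u i * (u j)^-1)).

Definition P (F : fieldType) (m : nat) (q : F) (u : nat -> F) : F :=
  sigma (q ^+ 4) ^- ((m - 1) * m.*2) * prefactor m.*2 q u *
  Pf m (fun i j => sigma (u i * (u j)^-1) /
          (sigma (q ^+ 2 * u i * u j) * sigma (q ^+ 2 * (u i)^-1 * (u j)^-1))).

Definition Q (F : fieldType) (m : nat) (q : F) (u : nat -> F) : F :=
  sigma (q ^+ 4) ^- ((m - 1) * (m.*2 - 1)) * prefactor (m.*2 - 1) q u *
  Pf m (fun i j =>
          if (j < m.*2)%N then
            sigma (u i * (u j)^-1) / sigma (q ^+ 2 * u i * u j)
            + sigma (u i * (u j)^-1) / sigma (q ^+ 2 * (u i)^-1 * (u j)^-1)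
          else 1).

(* Main.v *)
(* The lattice is cut into n nested lines around the central vertical line: line i
   goes down column i, right along row i and up column 2n+2-i. Adding the lines
   from the inside to the outside expresses Z_n through transfer matrices, whose
   Yang-Baxter and reflection equations show that Z_n is symmetric in u_1, ...,
   u_n. If u_n u_(n+1) = q^(-2) or q^2, then the innermost vertex splits into two
   turns: line n and the central line become a new central line with parameter
   u_n and a U-turn, which can be moved through the other lines to the side of
   the lattice. Hence Z_n reduces to an explicit multiple of
   Z_(n-1)(u_1, ..., u_(n-1); u_n).

   As a function of x = u_(n+1), Z_n is an even Laurent polynomial with exponents
   in [-n, n]. For n odd (resp. even) the variable x occurs in P (resp. Q) only;
   expanding the Pfaffian along the row of x shows that the product P Q is of the
   same kind and satisfies the same recursion at x = q^(-2)/u_i and q^2/u_i. This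
   determines Z_n by induction on n. *)
Require Import Defs.
From mathcomp Require Import all_boot all_order all_fingroup all_algebra.
From mathcomp Require Import mpoly ring zify.

Set Implicit Arguments.
Unset Strict Implicit.
Unset Printing Implicit Defensive.

Import GRing.Theory.
Local Open Scope ring_scope.

(** * Pfaffians *)

Section Pfaffian.
Variable F : fieldType.

(** The interpolation takes place at values in a field, not with indeterminates: [generic] lists
    what must not vanish, and only at the end is it checked for the indeterminates. This allows
    u_(n+1) to be specialised. The recursion then removes the special value from Z: the smaller Z
    involves only u_1, ..., u_n, and the induction hypothesis is applied to a rearrangement of them.

    Instead of proving that the denominators sigma (x / u_i) of the prefactor cancel, both sides are
    multiplied by their product. This raises the degree from n to 2n, so that 4n+1 zeros are needed
    and the 4n special points must be completed by one more.

    The recursion is visible for the innermost line only; symmetry transports it to every u_i. The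
    right-hand side needs the same symmetry, hence the sign of a Pfaffian under a permutation of its
    rows. A sum over matchings hides this sign, so it is compared with the sum over all
    permutations, at the cost of an integer factor that characteristic 0 makes invertible. *)

Definition pf_term m (A : nat -> nat -> F) (s : 'S_(m.*2)) : F :=
  (-1) ^+ s * \prod_(k < m) A (s (pair_fst k)) (s (pair_snd k)).

Definition pf m (A : nat -> nat -> F) : F :=
  \sum_(s : 'S_(m.*2) | is_matching s) pf_term A s.

Lemma eq_pf m (A B : nat -> nat -> F) :
  (forall i j, (i < j < m.*2)%N -> A i j = B i j) -> pf m A = pf m B.
Proof.
move=> eqAB; apply: eq_bigr => s /andP[/forallP sP _]; congr (_ * _).
by apply: eq_bigr => k _; rewrite eqAB // sP /=.
Qed.

Lemma lift_perm_onto n (s : 'S_n.+1) i j :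
  s i = j -> exists t : 'S_n, s = lift_perm i j t.
Proof.
move=> sij; pose f k := odflt k (unlift j (s (lift i k))).
have fE k : lift j (f k) = s (lift i k).
  rewrite /f; case: unliftP => [k' //|/=]; rewrite -sij => /perm_inj/eqP.
  by rewrite eq_sym (negbTE (neq_lift i k)).
have f_inj : injective f.
  by move=> k l /(congr1 (lift j)); rewrite !fE => /perm_inj/lift_inj.
exists (perm f_inj); apply/permP => k.
case: (unliftP i k) => [k' ->|->]; last by rewrite lift_perm_id.
by rewrite lift_perm_lift permE fE.
Qed.

Lemma lift_perm_inj n (i j : 'I_n.+1) : injective (@lift_perm n i j).
Proof.
move=> s t /permP st; apply/permP => k; apply: (@lift_inj _ j).
by rewrite -!(@lift_perm_lift _ i j) st.
Qed.

Lemma sum_perm_at n (G : 'S_n.+1 -> F) i j :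
  \sum_(s : 'S_n.+1 | s i == j) G s = \sum_(t : 'S_n) G (lift_perm i j t).
Proof.
transitivity (\sum_(s in [set lift_perm i j t | t in 'S_n]) G s).
  apply: eq_bigl => s; apply/eqP/imsetP => [/lift_perm_onto[t ->]|[t _ ->]].
    by exists t.
  exact: lift_perm_id.
rewrite big_imset /=; last by move=> ? ? _ _; apply: lift_perm_inj.
by apply: eq_bigl => t; rewrite inE.
Qed.

(** The array that remains once [0] has been paired with [j.+1]. *)
Definition minor (A : nat -> nat -> F) (j : nat) : nat -> nat -> F :=
  fun p r => A (bump j p).+1 (bump j r).+1.

(** The permutation that starts with the pair [0], [j.+1] and continues with [t] on the remaining
    indices. *)
Definition lift2 m (j : 'I_(m.*2.+1)) (t : 'S_(m.*2)) : 'S_(m.+1.*2) :=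
  lift_perm ord0 ord0 (lift_perm ord0 j t).

Lemma sum_lift2 m (G : 'S_(m.+1.*2) -> F) :
  \sum_(s : 'S_(m.+1.*2) | s ord0 == ord0) G s =
  \sum_(j : 'I_(m.*2.+1)) \sum_(t : 'S_(m.*2)) G (lift2 j t).
Proof.
rewrite (@sum_perm_at m.*2.+1 G) (partition_big (fun s : 'S_(m.*2.+1) => s ord0) xpredT) //=.
by apply: eq_bigr => j _; rewrite (@sum_perm_at m.*2 _ ord0 j).
Qed.

Lemma pair_fst0 m : @pair_fst m.+1 ord0 = ord0.
Proof. exact: val_inj. Qed.

Lemma pair_snd0 m : @pair_snd m.+1 ord0 = lift ord0 ord0 :> 'I_m.*2.+2.
Proof. exact: val_inj. Qed.

Lemma pair_fstS m (k : 'I_m) :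
  pair_fst (lift ord0 k) = lift ord0 (lift ord0 (pair_fst k)) :> 'I_m.*2.+2.
Proof. exact: val_inj. Qed.

Lemma pair_sndS m (k : 'I_m) :
  pair_snd (lift ord0 k) = lift ord0 (lift ord0 (pair_snd k)) :> 'I_m.*2.+2.
Proof. exact: val_inj. Qed.

Lemma lift2_fst0 m (j : 'I_(m.*2.+1)) t : lift2 j t (pair_fst ord0) = ord0.
Proof. by rewrite pair_fst0 /lift2 lift_perm_id. Qed.

Lemma lift2_snd0 m (j : 'I_(m.*2.+1)) t : lift2 j t (pair_snd ord0) = j.+1 :> nat.
Proof. by rewrite pair_snd0 /lift2 lift_perm_lift lift_perm_id. Qed.

Lemma lift2_fstS m (j : 'I_(m.*2.+1)) t (k : 'I_m) :
  lift2 j t (pair_fst (lift ord0 k)) = (bump j (t (pair_fst k))).+1 :> nat.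
Proof. by rewrite pair_fstS /lift2 !lift_perm_lift. Qed.

Lemma lift2_sndS m (j : 'I_(m.*2.+1)) t (k : 'I_m) :
  lift2 j t (pair_snd (lift ord0 k)) = (bump j (t (pair_snd k))).+1 :> nat.
Proof. by rewrite pair_sndS /lift2 !lift_perm_lift. Qed.

Lemma odd_lift2 m (j : 'I_(m.*2.+1)) t : lift2 j t = odd j (+) t :> bool.
Proof.
have := @odd_lift_perm m.*2.+1 ord0 ord0 (lift_perm ord0 j t).
by rewrite (@odd_lift_perm m.*2).
Qed.

Lemma pf_term_lift2 m A (j : 'I_(m.*2.+1)) t :
  pf_term A (lift2 j t) = (-1) ^+ j * A 0%N j.+1 * pf_term (minor A j) t.
Proof.
rewrite /pf_term big_ord_recl lift2_fst0 lift2_snd0 /=.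
under eq_bigr do rewrite lift2_fstS lift2_sndS.
rewrite odd_lift2 signr_addb signr_odd -!mulrA; congr (_ * _).
by rewrite mulrCA.
Qed.

Lemma ltn_bump2 j p r : (bump j p < bump j r)%N = (p < r)%N.
Proof. by rewrite !ltnNge leq_bump2. Qed.

Lemma is_matching_lift2 m (j : 'I_(m.*2.+1)) t :
  is_matching (lift2 j t) = is_matching t.
Proof.
apply/andP/andP => -[/forallP mP /forallP mQ]; split; apply/forallP => k.
- by have := mP (lift ord0 k); rewrite lift2_fstS lift2_sndS ltnS ltn_bump2.
- apply/forallP => l; have /forallP/(_ (lift ord0 l)) := mQ (lift ord0 k).
  by rewrite !lift2_fstS !ltnS ltn_bump2.
- case: (unliftP ord0 k) => [k' ->|->]; last by rewrite lift2_fst0 lift2_snd0.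
  by rewrite lift2_fstS lift2_sndS ltnS ltn_bump2.
apply/forallP => l; case: (unliftP ord0 l) => [l' ->|->]; last by rewrite ltn0.
rewrite lift2_fstS; case: (unliftP ord0 k) => [k' ->|->]; last first.
  by rewrite lift2_fst0 implybT.
rewrite lift2_fstS ltnS ltn_bump2 /= /bump !add1n ltnS.
by have /forallP := mQ k'.
Qed.

Lemma pairP m (i : 'I_(m.*2)) :
  (exists k : 'I_m, i = pair_fst k) \/ (exists k : 'I_m, i = pair_snd k).
Proof.
have lt_m : (i./2 < m)%N by have := ltn_ord i; lia.
have := odd_double_half i; case odd_i: (odd i) => iE; [right|left];
  exists (Ordinal lt_m); apply: val_inj => /=; lia.
Qed.

(** The index 0 is the smaller entry of its pair, and that pair is listed first. *)
Lemma is_matching0 m (s : 'S_(m.+1.*2)) : is_matching s -> s ord0 = ord0.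
Proof.
move=> /andP[/forallP mP /forallP mQ].
have [] := pairP ((s^-1)%g ord0) => -[k /(congr1 s)]; rewrite permKV => sk.
  case: (unliftP ord0 k) sk => [k' ->|->]; last by rewrite pair_fst0.
  have /forallP/(_ (lift ord0 k')) := mQ ord0.
  by move=> + sk; rewrite -sk ltn0 implybF.
by have := mP k; rewrite -sk.
Qed.

(** A matching consists of the partner [j.+1] of [0] and a matching of the rest; moving [j.+1] next
    to [0] costs the sign [(-1) ^+ j]. *)
Lemma pf_expand m A :
  pf m.+1 A = \sum_(j < m.*2.+1) (-1) ^+ j * A 0%N j.+1 * pf m (minor A j).
Proof.
transitivity (\sum_(s : 'S_(m.+1.*2) | s ord0 == ord0)
   if is_matching s then pf_term A s else 0).
  rewrite -big_mkcondr; apply: eq_bigl => s.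
  by apply/idP/andP => [ms|[]//]; rewrite (is_matching0 ms).
rewrite sum_lift2; apply: eq_bigr => j _; rewrite /pf mulr_sumr [RHS]big_mkcond.
by apply: eq_bigr => t _; rewrite is_matching_lift2 pf_term_lift2.
Qed.

(** The chosen representatives of the matchings are not stable under composition with a permutation,
    whereas the set of all permutations is; this is why [pf_perm] takes the detour over this sum. *)
Definition pf_full m (A : nat -> nat -> F) : F := \sum_(s : 'S_(m.*2)) pf_term A s.

Definition antisymmetric_array (A : nat -> nat -> F) := forall i j, A i j = - A j i.

Lemma pair_fst_inj m : injective (@pair_fst m).
Proof. by move=> k l /(congr1 val) /= kl; apply: val_inj; rewrite /=; lia. Qed.

Lemma pair_snd_inj m : injective (@pair_snd m).
Proof. by move=> k l /(congr1 val) /= kl; apply: val_inj; rewrite /=; lia. Qed.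

Lemma pair_fst_neq_snd m (k l : 'I_m) : pair_fst k != pair_snd l.
Proof. by apply/eqP => /(congr1 val) /=; lia. Qed.

Lemma pf_term_flip m A (s : 'S_(m.*2)) k : antisymmetric_array A ->
  pf_term A (tperm (pair_fst k) (pair_snd k) * s)%g = pf_term A s.
Proof.
move=> asA; rewrite /pf_term (bigD1 k) //= [in RHS](bigD1 k) //=.
rewrite !permM tpermL tpermR asA odd_mul_tperm pair_fst_neq_snd signrN.
rewrite !mulNr mulrN opprK; congr (_ * (_ * _)); apply: eq_bigr => i ik.
rewrite !permM !tpermD // ?(inj_eq (@pair_fst_inj m)) //.
- by rewrite pair_fst_neq_snd.
- by rewrite (inj_eq (@pair_snd_inj m)) eq_sym.
- by rewrite eq_sym.
- by rewrite eq_sym pair_fst_neq_snd.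
Qed.

Definition tblock m (k l : 'I_m) : 'S_(m.*2) :=
  (tperm (pair_fst k) (pair_fst l) * tperm (pair_snd k) (pair_snd l))%g.

Lemma tblock_fst m (k l i : 'I_m) : tblock k l (pair_fst i) = pair_fst (tperm k l i).
Proof.
rewrite /tblock permM -(inj_tperm k l i (@pair_fst_inj m)).
by rewrite (@tpermD _ (pair_snd k)) // eq_sym pair_fst_neq_snd.
Qed.

Lemma tblock_snd m (k l i : 'I_m) : tblock k l (pair_snd i) = pair_snd (tperm k l i).
Proof.
rewrite /tblock permM (@tpermD _ (pair_fst k)) ?pair_fst_neq_snd //.
by rewrite -(inj_tperm k l i (@pair_snd_inj m)).
Qed.

Lemma odd_tblock m (k l : 'I_m) : tblock k l = false :> bool.
Proof.
rewrite /tblock odd_permM !odd_tperm.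
by rewrite (inj_eq (@pair_fst_inj m)) (inj_eq (@pair_snd_inj m)) addbb.
Qed.

Lemma pf_term_block m A (s : 'S_(m.*2)) k l :
  pf_term A (tblock k l * s)%g = pf_term A s.
Proof.
rewrite /pf_term odd_permM odd_tblock addFb; congr (_ * _).
rewrite [RHS](reindex_inj (@perm_inj _ (tperm k l))) /=.
by apply: eq_bigr => i _; rewrite !(permM (tblock k l)) tblock_fst tblock_snd.
Qed.

(* Swapping two pairs, or the entries of a pair, does not change a term, so the
   preimage of 0 may be taken to be 0. *)
Lemma sum_pf_term_at m A (p : 'I_(m.+1.*2)) : antisymmetric_array A ->
  \sum_(s : 'S_(m.+1.*2) | s p == ord0) pf_term A s =
  \sum_(s : 'S_(m.+1.*2) | s ord0 == ord0) pf_term A s.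
Proof.
move=> asA; have at_fst k :
    \sum_(s : 'S_(m.+1.*2) | s (pair_fst k) == ord0) pf_term A s =
    \sum_(s : 'S_(m.+1.*2) | s ord0 == ord0) pf_term A s.
  rewrite (reindex_inj (mulgI (tblock k ord0))) /=; apply: eq_big => s.
    by rewrite permM tblock_fst tpermL pair_fst0.
  by rewrite pf_term_block.
have [[k ->]|[k ->]] := pairP p; rewrite -(at_fst k) //.
rewrite (reindex_inj (mulgI (tperm (pair_fst k) (pair_snd k)))) /=.
by apply: eq_big => s; rewrite ?pf_term_flip // permM tpermR.
Qed.

Lemma antisymmetric_minor A j :
  antisymmetric_array A -> antisymmetric_array (minor A j).
Proof. by move=> asA p r; apply: asA. Qed.

(** The value 0 may occur at any of the [m.+1.*2] positions, each with the same contribution. *)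
Lemma pf_full_expand m A : antisymmetric_array A ->
  pf_full m.+1 A = \sum_(j < m.*2.+1) (-1) ^+ j * A 0%N j.+1 * pf_full m (minor A j)
                    *+ m.+1.*2.
Proof.
move=> asA; rewrite /pf_full.
rewrite (partition_big (fun s : 'S_(m.+1.*2) => (s^-1)%g ord0) xpredT) //=.
rewrite (eq_bigr (fun=> \sum_(s : 'S_(m.+1.*2) | s ord0 == ord0) pf_term A s)).
  rewrite sumr_const card_ord sum_lift2 sumrMnl; congr (_ *+ _).
  apply: eq_bigr => j _; rewrite mulr_sumr.
  by apply: eq_bigr => t _; rewrite pf_term_lift2.
move=> p _; rewrite -(sum_pf_term_at p asA); apply: eq_bigl => s.
by rewrite (canF_eq (permK s)) eq_sym.
Qed.

(* Both sums satisfy the same expansion along row 0, up to a factor 2m. *)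
Lemma pf_fullE : [pchar F] =i pred0 -> forall m, exists2 c : F, c != 0 &
  forall A, antisymmetric_array A -> pf_full m A = c * pf m A.
Proof.
move=> charF; elim=> [|m [c c0 IH]].
  exists 1 => [|A _]; rewrite ?oner_eq0 // mul1r /pf /pf_full; apply: eq_bigl => s.
  by apply/esym/andP; split; apply/forallP => -[].
exists (m.+1.*2%:R * c) => [|A asA].
  by rewrite mulf_neq0 //; move/GRing.pcharf0P: charF => ->.
rewrite pf_full_expand // pf_expand mulr_sumr; apply: eq_bigr => j _.
by rewrite IH; [rewrite -mulr_natl; ring | apply: antisymmetric_minor].
Qed.

Lemma pf_perm m A B (t : 'S_(m.*2)) : [pchar F] =i pred0 ->
    antisymmetric_array A -> antisymmetric_array B ->
    (forall i j : 'I_(m.*2), B i j = A (t i) (t j)) ->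
  pf m B = (-1) ^+ t * pf m A.
Proof.
move=> charF asA asB BE; have [c c0 fullE] := pf_fullE charF m.
apply: (mulfI c0); rewrite mulrCA -!fullE // /pf_full.
rewrite [in RHS](reindex_inj (mulIg t)) mulr_sumr /=; apply: eq_bigr => s _.
rewrite /pf_term odd_permM addbC signr_addb !mulrA -expr2 sqrr_sign mul1r.
by congr (_ * _); apply: eq_bigr => k _; rewrite BE !permM.
Qed.

(** * Pfaffians indexed by lists *)

Section Lists.
Variables (T : Type) (x0 : T) (f : T -> T -> F).

Definition pfl (s : seq T) : F :=
  pf (size s)./2 (fun i j => f (nth x0 s i) (nth x0 s j)).

Lemma pfl_cons x s : odd (size s) ->
  pfl (x :: s) = \sum_(j < size s)
    (-1) ^+ j * f x (nth x0 s j) * pfl (take j s ++ drop j.+1 s).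
Proof.
move=> odd_s; rewrite /pfl /= uphalf_half odd_s add1n pf_expand.
have sz_s : size s = (size s)./2.*2.+1 by have := odd_double_half (size s); lia.
rewrite -sz_s; apply: eq_bigr => j _; congr (_ * _).
have szE : size (take j s ++ drop j.+1 s) = (size s).-1.
  by rewrite size_cat size_takel ?size_drop; have := ltn_ord j; lia.
have -> : (size (take j s ++ drop j.+1 s))./2 = (size s)./2 by rewrite szE; lia.
apply: eq_pf => p r _; rewrite /minor /=.
suff nthE i : nth x0 (take j s ++ drop j.+1 s) i = nth x0 s (bump j i) by rewrite !nthE.
rewrite nth_cat size_takel; last by have := ltn_ord j; lia.
rewrite /bump; case: ltnP => ij; first by rewrite nth_take.
rewrite nth_drop; congr (nth _ _ _); lia.
Qed.

Hypotheses (charF : [pchar F] =i pred0) (asf : forall x y, f x y = - f y x).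

(** Used twice: for the symmetry of the right-hand side in its parameters, and with [x = y] to make
    a Pfaffian vanish. *)
Lemma pfl_swap pre x y post : ~~ odd (size pre + size post) ->
  pfl (pre ++ x :: y :: post) = - pfl (pre ++ y :: x :: post).
Proof.
move=> even_s; rewrite /pfl !size_cat /=.
set m := (_ + _)./2; have mE : m.*2 = (size pre + size post).+2.
  by rewrite /m; lia.
have lt1 : (size pre < m.*2)%N by lia.
have lt2 : ((size pre).+1 < m.*2)%N by lia.
rewrite (@pf_perm m (fun i j => f (nth x0 (pre ++ y :: x :: post) i)
    (nth x0 (pre ++ y :: x :: post) j)) _ (tperm (Ordinal lt1) (Ordinal lt2))) //.
  have -> : odd_perm (tperm (Ordinal lt1) (Ordinal lt2)).
    by rewrite odd_tperm; apply/eqP => /(congr1 val) /=; lia.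
  by rewrite expr1 mulN1r.
move=> i j /=.
suff nthE (k : 'I_m.*2) : nth x0 (pre ++ x :: y :: post) k = nth x0 (pre ++ y :: x :: post)
   (tperm (Ordinal lt1) (Ordinal lt2) k) by rewrite !nthE.
rewrite !nth_cat; case: tpermP => [->|->|] /=.
- by rewrite ltnn subnn ltnNge leqnSn /= subSnn.
- by rewrite ltnn subnn ltnNge leqnSn /= subSnn.
move=> k1 k2; case: ltnP => // lek.
case: (_ - _)%N (subnKC lek) => [|[|d]] // kE.
- by case: k1; apply: val_inj; rewrite /= -kE addn0.
- by case: k2; apply: val_inj; rewrite /= -kE addn1.
Qed.
End Lists.
End Pfaffian.

(** * Local relations of the six-vertex model *)

Section VertexModel.
Variables (F : fieldType) (q : F).

(* The bits n and s say that the vertical edges point up, and the bits w and e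
   that the horizontal edges point right, whereas the bits of [bulk_weight]
   refer to outgoing edges. *)
Definition bulk (u : F) (n s w e : bool) : F :=
  if n == s then
    if w == e then
      (if n == w then sigma (q ^+ 2 * u) else sigma (q ^+ 2 * u^-1))
        / sigma (q ^+ 4)
    else 0
  else ((n == w) && (s == e))%:R.

(* Crossing of two neighbouring lines with parameters c and d; (a, b) are the
   states after the crossing and (a', b') those before. *)
Definition rmat (c d : F) (a b a' b' : bool) : F :=
  if a == b then (if (a' == a) && (b' == b) then sigma (q ^+ 4 * d / c) / sigma (q ^+ 4) else 0)
  else if a' == b' then 0
  else if a == a' then 1 else sigma (c / d) / sigma (q ^+ 4).

Hypotheses (q0 : q != 0) (s40 : sigma (q ^+ 4) != 0).

(** The form in which [field] asks for the nonvanishing of [sigma (q ^+ 4)]. *)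
Let q8 : (q * q) ^+ 4 - 1 != 0.
Proof.
apply: contra s40 => /eqP h8; apply/eqP; rewrite /sigma.
have -> : q ^+ 4 - q ^- 4 = ((q * q) ^+ 4 - 1) / q ^+ 4 by field.
by rewrite h8 mul0r.
Qed.

Let simp := (@mul0r F, @mulr0 F, @addr0 F, @add0r F, @mulr1 F, @mul1r F).

(** Yang-Baxter equation for two crossing columns and a row, checked in each of the 64 boundary
    states. *)
Lemma rmat_bulk_col (u c d : F) t1 t2 h k s1 s2 :
    u != 0 -> c != 0 -> d != 0 ->
  \sum_(a : bool) \sum_(b : bool) \sum_(e : bool)
     bulk (u * d) t1 a h e * bulk (u * c) t2 b e k * rmat c d a b s1 s2 =
  \sum_(a : bool) \sum_(b : bool) \sum_(e : bool)
     rmat c d t1 t2 a b * (bulk (u * c) a s1 h e * bulk (u * d) b s2 e k).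
Proof.
move=> u0 c0 d0; rewrite !big_bool.
case: t1; case: t2; case: h; case: k; case: s1; case: s2;
  rewrite /bulk /rmat /= ?simp //; rewrite /sigma; field;
  by rewrite ?q0 ?q8 ?u0 ?c0 ?d0.
Qed.

(** Yang-Baxter equation for two crossing rows and a column, which pushes a crossing along the
    horizontal parts of two lines. *)
Lemma rmat_bulk_row (u w c : F) h k h' k' t s :
    u != 0 -> w != 0 -> c != 0 ->
  \sum_(a : bool) \sum_(b : bool) \sum_(r : bool)
     rmat u w h k a b * (bulk (u * c) t r a h' * bulk (w * c) r s b k') =
  \sum_(a : bool) \sum_(b : bool) \sum_(r : bool)
     bulk (w * c) t r h a * bulk (u * c) r s k b * rmat u w a b h' k'.
Proof.
move=> u0 w0 c0; rewrite !big_bool.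
case: t; case: s; case: h; case: k; case: h'; case: k';
  rewrite /bulk /rmat /= ?simp //; rewrite /sigma; field;
  by rewrite ?q0 ?q8 ?u0 ?w0 ?c0.
Qed.

(** Reflection equation on the left. A corner keeps the bit and has weight 1, so no boundary matrix
    is left: the crossing is only exchanged with the vertex of label [u * w]. *)
Lemma rmat_bulk_left (u w : F) a b h k : u != 0 -> w != 0 ->
  \sum_(a' : bool) \sum_(b' : bool)
     rmat u w a b a' b' * bulk (u * w) b' k a' h =
  \sum_(h' : bool) \sum_(k' : bool)
     bulk (u * w) b k' a h' * rmat u w h' k' h k.
Proof.
move=> u0 w0; rewrite !big_bool.
case: a; case: b; case: h; case: k;
  rewrite /bulk /rmat /= ?simp //; rewrite /sigma; field;
  by rewrite ?q0 ?q8 ?u0 ?w0.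
Qed.

(** Reflection equation on the right. Here a corner negates the bit: an edge that points right
    enters the boundary vertex, so the upper edge has to point down. *)
Lemma rmat_bulk_right (u w : F) a b h k : u != 0 -> w != 0 ->
  \sum_(h' : bool) \sum_(k' : bool)
     rmat u w h k h' k' * bulk (u * w) a (~~ k') h' (~~ b) =
  \sum_(a' : bool) \sum_(b' : bool)
     rmat u w a b a' b' * bulk (u * w) a' (~~ k) h (~~ b').
Proof.
move=> u0 w0; rewrite !big_bool.
case: a; case: b; case: h; case: k;
  rewrite /bulk /rmat /= ?simp //; rewrite /sigma; field;
  by rewrite ?q0 ?q8 ?u0 ?w0.
Qed.

(* When q^2 c d = 1, the crossing of the lines c and d turns into two U-turns, one
   of which joins two neighbouring columns; a row passes through such a U-turn
   at the cost of two crossings. *)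
Lemma rmat_cap_right (u c d : F) h y z b :
    u != 0 -> d != 0 -> c = (q ^+ 2 * d)^-1 ->
  \sum_(e : bool) \sum_(k : bool)
     bulk (u * c) y e h k * bulk (u * d) z e k (~~ b) =
  \sum_(z' : bool) \sum_(b' : bool)
     rmat u d z b z' b' * rmat u c y z' (~~ h) b'.
Proof.
move=> u0 d0 ->; rewrite !big_bool.
case: y; case: z; case: h; case: b;
  rewrite /bulk /rmat /= ?simp //; rewrite /sigma; field;
  by rewrite ?q0 ?q8 ?u0 ?d0 ?oner_eq0.
Qed.

Lemma rmat_cap_left (u c d : F) a y z h :
    u != 0 -> d != 0 -> c = q ^+ 2 / d ->
  \sum_(e : bool) \sum_(k : bool)
     bulk (u * d) y e a k * bulk (u * c) z e k h =
  \sum_(y' : bool) \sum_(a' : bool)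
     rmat d u a y y' a' * rmat c u a' z y' h.
Proof.
move=> u0 d0 ->; rewrite !big_bool.
case: y; case: z; case: h; case: a;
  rewrite /bulk /rmat /= ?simp //; rewrite /sigma; field;
  by rewrite ?q0 ?q8 ?u0 ?d0 ?oner_eq0.
Qed.

(** * Transfer matrices *)

(* A state assigns an amplitude to the orientations of the vertical edges in a
   row of the lattice. *)
Definition vstate := seq bool -> F.

(* The sum over a row of the triangle to the right of a horizontal edge in state
   h. The last bit of top belongs to the right boundary vertex, whose two edges
   are both incoming or both outgoing, that is, h != b. *)
Fixpoint row (u : F) (cs : seq F) (h : bool) (top : seq bool) (psi : vstate) : F :=
  match cs, top with
  | [::], [:: b] => if h == b then 0 else psi [::]
  | c :: cs', t :: top' =>
      \sum_(s : bool) \sum_(e : bool)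
         bulk (u * c) t s h e * row u cs' e top' (fun l => psi (s :: l))
  | _, _ => 0
  end.

(* At a left boundary vertex the edge to the right points right exactly when the
   upper edge points up. *)
Definition layer (u : F) (cs : seq F) (psi : vstate) : vstate :=
  fun l => if l is a :: l' then row u cs a l' psi else 0.

Fixpoint braid (c d : F) (k : nat) (psi : vstate) (l : seq bool) : F :=
  match k, l with
  | 0, x :: y :: l' =>
      \sum_(a : bool) \sum_(b : bool) rmat c d x y a b * psi (a :: b :: l')
  | k'.+1, x :: l' => braid c d k' (fun m => psi (x :: m)) l'
  | _, _ => 0
  end.

(** The U-turns that arise contain a corner of the lattice, where the arrow is reversed; hence the
    two bits are equal instead of opposite. *)
Fixpoint cap (k : nat) (psi : vstate) (l : seq bool) : F :=
  match k, l with
  | 0, x :: y :: l' => if x == y then psi l' else 0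
  | k'.+1, x :: l' => cap k' (fun m => psi (x :: m)) l'
  | _, _ => 0
  end.

Lemma eq_row u cs h top psi psi' :
    (forall l, size l = size cs -> psi l = psi' l) ->
  row u cs h top psi = row u cs h top psi'.
Proof.
elim: cs h top psi psi' => [|c cs IH] h [|t top] psi psi' eq_psi //=.
  by case: top => //; rewrite eq_psi.
do 2!apply: eq_bigr => ? _; congr (_ * _).
by apply: IH => l sz_l; apply: eq_psi; rewrite /= sz_l.
Qed.

Lemma row_sum u cs h top (I : finType) (f : I -> vstate) :
  row u cs h top (fun l => \sum_i f i l) = \sum_i row u cs h top (f i).
Proof.
elim: cs h top f => [|c cs IH] h [|t top] f /=; rewrite ?big1_eq //.
  by case: top => [|? ?]; rewrite ?big1_eq //; case: eqP; rewrite ?big1_eq.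
rewrite [RHS]exchange_big /=; apply: eq_bigr => s _.
rewrite [RHS]exchange_big /=; apply: eq_bigr => e _.
by rewrite IH mulr_sumr.
Qed.

Lemma rowZ u cs h top a (f : vstate) :
  row u cs h top (fun l => a * f l) = a * row u cs h top f.
Proof.
elim: cs h top f => [|c cs IH] h [|t top] f /=; rewrite ?mulr0 //.
  by case: top => [|? ?]; rewrite ?mulr0 //; case: eqP; rewrite ?mulr0.
rewrite mulr_sumr; apply: eq_bigr => s _.
rewrite mulr_sumr; apply: eq_bigr => e _.
by rewrite IH mulrCA.
Qed.

Lemma eq_braid c d k (psi psi' : vstate) l :
    (forall m, size m = size l -> psi m = psi' m) ->
  braid c d k psi l = braid c d k psi' l.
Proof.
elim: k psi psi' l => [|k IH] psi psi' [|x l] eq_psi //=.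
  case: l eq_psi => [|y l] eq_psi //.
  by do 2!apply: eq_bigr => ? _; rewrite eq_psi.
by apply: IH => m sz_m; apply: eq_psi; rewrite /= sz_m.
Qed.

Lemma braid_sum c d k (I : finType) (f : I -> vstate) l :
  braid c d k (fun m => \sum_i f i m) l = \sum_i braid c d k (f i) l.
Proof.
elim: k f l => [|k IH] f [|x l] /=; rewrite ?big1_eq //.
case: l => [|y l]; rewrite ?big1_eq //.
rewrite [RHS]exchange_big /=; apply: eq_bigr => a _.
rewrite [RHS]exchange_big /=; apply: eq_bigr => b _.
by rewrite mulr_sumr.
Qed.

Lemma braidZ c d k a (f : vstate) l :
  braid c d k (fun m => a * f m) l = a * braid c d k f l.
Proof.
elim: k f l => [|k IH] f [|x l] /=; rewrite ?mulr0 //.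
case: l => [|y l]; rewrite ?mulr0 //.
rewrite mulr_sumr; apply: eq_bigr => i _.
rewrite mulr_sumr; apply: eq_bigr => j _.
by rewrite mulrCA.
Qed.

(** The row reaches the two crossed columns after those of [pre], which the induction peels off;
    there [rmat_bulk_col] applies. *)
Lemma row_braid u c d pre post h top psi :
    u != 0 -> c != 0 -> d != 0 -> size top = (size pre + size post).+3 ->
  row u (pre ++ d :: c :: post) h top (braid c d (size pre) psi) =
  braid c d (size pre) (fun m => row u (pre ++ c :: d :: post) h m psi) top.
Proof.
move=> u0 c0 d0; elim: pre h top psi => [|p pre IH] h [|t top] psi //= sz_top.
  case: top sz_top => [|t2 top] //= sz_top.
  (* What lies to the right of the two columns is the same on both sides. *)
  pose X e a b := row u post e top (fun l => psi (a :: b :: l)).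
  transitivity (\sum_(e : bool) \sum_(a : bool) \sum_(b : bool)
     (\sum_(s1 : bool) \sum_(s2 : bool) \sum_(e' : bool)
       bulk (u * d) t s1 h e' * bulk (u * c) t2 s2 e' e * rmat c d s1 s2 a b)
      * X e a b).
    rewrite !big_bool /= !(row_sum, big_bool, rowZ) /= -!/(X _ _ _); ring.
  transitivity (\sum_(e : bool) \sum_(a : bool) \sum_(b : bool)
     (\sum_(x : bool) \sum_(y : bool) \sum_(e' : bool)
       rmat c d t t2 x y * (bulk (u * c) x a h e' * bulk (u * d) y b e' e))
      * X e a b).
    do 3!apply: eq_bigr => ? _; congr (_ * _).
    exact: rmat_bulk_col.
  rewrite !big_bool /= -!/(X _ _ _); ring.
transitivity (\sum_(s : bool) \sum_(e : bool)
    bulk (u * p) t s h e * braid c d (size pre)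
      (fun m => row u (pre ++ c :: d :: post) e m (fun l => psi (s :: l))) top).
  do 2!apply: eq_bigr => ? _; congr (_ * _); apply: IH.
  by case: sz_top.
by rewrite braid_sum; apply: eq_bigr => s _; rewrite braid_sum;
  apply: eq_bigr => e _; rewrite braidZ.
Qed.

(** Two consecutive lines without their left ends. The upper row has one more column than the lower
    one: the part of the line [w] that rises on the right. *)
Definition double_row (u w : F) cs h k top (psi : vstate) : F :=
  row u (cs ++ [:: w]) h top (fun l => row w cs k l psi).

Lemma double_row_cons u w c cs h k t top psi :
  double_row u w (c :: cs) h k (t :: top) psi =
  \sum_(r : bool) \sum_(a : bool) bulk (u * c) t r h a *
  \sum_(s : bool) \sum_(b : bool) bulk (w * c) r s k b *
  double_row u w cs a b top (fun l => psi (s :: l)).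
Proof.
rewrite /double_row /=; apply: eq_bigr => r _; apply: eq_bigr => a _.
congr (_ * _); rewrite row_sum; apply: eq_bigr => s _.
by rewrite row_sum; apply: eq_bigr => b _; rewrite rowZ.
Qed.

(** [rmat_bulk_row] pushes the crossing of the two rows to the right, column by column; at the end
    [rmat_bulk_right] turns it into a crossing of the last two columns. *)
Lemma double_row_braid u w cs h k top psi :
    u != 0 -> w != 0 -> all (fun c => c != 0) cs ->
    size top = (size cs).+2 ->
  \sum_(h' : bool) \sum_(k' : bool)
     rmat u w h k h' k' * double_row u w cs h' k' top psi =
  braid u w (size cs) (fun m => double_row w u cs h k m psi) top.
Proof.
move=> u0 w0; elim: cs h k top psi => [|c cs IH] h k.
  move=> [|a [|b []]] psi //= _ _.
  transitivity ((\sum_(h' : bool) \sum_(k' : bool)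
     rmat u w h k h' k' * bulk (u * w) a (~~ k') h' (~~ b)) * psi [::]).
    rewrite /double_row !big_bool /= !big_bool /=.
    by case: b => /=; rewrite ?(mulr0, addr0, add0r); ring.
  rewrite rmat_bulk_right //.
  rewrite /double_row !big_bool /= !big_bool /= [w * u]mulrC.
  by case: k => /=; rewrite ?(mulr0, addr0, add0r); ring.
move=> [|t top] psi //= /andP[c0 cs0] [sz_top].
pose X s a b := double_row u w cs a b top (fun l => psi (s :: l)).
transitivity (\sum_(s : bool) \sum_(h' : bool) \sum_(k' : bool)
   (\sum_(a : bool) \sum_(b : bool) \sum_(r : bool)
     rmat u w h k a b * (bulk (u * c) t r a h' * bulk (w * c) r s b k'))
   * X s h' k').
  under eq_bigr => h' _ do under eq_bigr => k' _ do rewrite double_row_cons.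
  rewrite !big_bool /= -!/(X _ _ _); ring.
transitivity (\sum_(s : bool) \sum_(a : bool) \sum_(b : bool) \sum_(r : bool)
  bulk (w * c) t r h a * bulk (u * c) r s k b *
  braid u w (size cs)
    (fun m => double_row w u cs a b m (fun l => psi (s :: l))) top).
  transitivity (\sum_(s : bool) \sum_(a : bool) \sum_(b : bool) \sum_(r : bool)
    bulk (w * c) t r h a * bulk (u * c) r s k b *
    \sum_(h' : bool) \sum_(k' : bool) rmat u w a b h' k' * X s h' k').
    under eq_bigr => s _ do under eq_bigr => h' _ do under eq_bigr => k' _ do
      rewrite rmat_bulk_row //.
    rewrite !big_bool /=; ring.
  by do 4!apply: eq_bigr => ? _; congr (_ * _); apply: IH.
rewrite (@eq_braid u w _ _ (fun m =>
  \sum_(r : bool) \sum_(a : bool) \sum_(s : bool) \sum_(b : bool)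
    bulk (w * c) t r h a * bulk (u * c) r s k b *
    double_row w u cs a b m (fun l => psi (s :: l)))); last first.
  move=> m _; rewrite double_row_cons; apply: eq_bigr => r _.
  apply: eq_bigr => a _; rewrite mulr_sumr; apply: eq_bigr => s _.
  by rewrite mulr_sumr; apply: eq_bigr => b _; rewrite mulrA.
rewrite braid_sum !big_bool !braid_sum !big_bool !braid_sum !big_bool.
rewrite !braid_sum !big_bool !braidZ /=; ring.
Qed.

(** The crossing of the two left columns is carried around the left corners, along both rows and up
    on the right; behind it the two lines have changed places. *)
Lemma layer_exchange u w cs psi l :
    u != 0 -> w != 0 -> all (fun c => c != 0) cs ->
    size l = (size cs).+4 ->
  braid u w 0 (layer u (w :: cs ++ [:: w]) (layer w cs psi)) l =
  braid u w (size cs).+2 (layer w (u :: cs ++ [:: u]) (layer u cs psi)) l.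
Proof.
move=> u0 w0 cs0; case: l => [|a [|b top]] // [sz_top].
pose X h k := double_row u w cs h k top psi.
transitivity (\sum_(h : bool) \sum_(k : bool)
  (\sum_(a' : bool) \sum_(b' : bool)
     rmat u w a b a' b' * bulk (u * w) b' k a' h) * X h k).
  rewrite /= !big_bool /=. by rewrite -!/(double_row _ _ _ _ _ _ _)
    -!/(X _ _); ring.
transitivity (\sum_(h : bool) \sum_(k : bool) bulk (u * w) b k a h *
    \sum_(h' : bool) \sum_(k' : bool) rmat u w h k h' k' * X h' k').
  under eq_bigr => h _ do under eq_bigr => k _ do rewrite rmat_bulk_left //.
  rewrite !big_bool /=; ring.
rewrite /= braid_sum exchange_big /=; apply: eq_bigr => k _.
rewrite braid_sum; apply: eq_bigr => h _.
by rewrite braidZ double_row_braid // [w * u]mulrC.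
Qed.

(** * Nested lines and the symmetry of Z *)

Definition wrap (u : F) (cs : seq F) := u :: cs ++ [:: u].

Fixpoint layers (us cs : seq F) (psi : vstate) : vstate :=
  if us is u :: us' then layer u (foldr wrap cs us') (layers us' cs psi)
  else psi.

Definition cols (us : seq F) (x : F) := foldr wrap [:: x] us.

Definition vec (us : seq F) (x : F) : vstate := layers us [:: x] (fun=> 1).

Definition Zvec (us : seq F) (x : F) : F :=
  vec us x (nseq (size us).*2.+1 true).

Lemma size_wraps us cs : size (foldr wrap cs us) = ((size us).*2 + size cs)%N.
Proof. by elim: us => //= u us IH; rewrite size_cat /= IH addn1. Qed.

Lemma size_cols us x : size (cols us x) = (size us).*2.+1.
Proof. by rewrite size_wraps addn1. Qed.

Lemma layers_cat us us' cs psi :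
  layers (us ++ us') cs psi = layers us (foldr wrap cs us') (layers us' cs psi).
Proof. by elim: us => //= u us ->; rewrite foldr_cat. Qed.

Lemma eq_layer u cs (psi psi' : vstate) l :
    (forall l, size l = size cs -> psi l = psi' l) ->
  layer u cs psi l = layer u cs psi' l.
Proof. by case: l => //= a l eq_psi; apply: eq_row. Qed.

Lemma layer_braid u c d pre post psi l :
    u != 0 -> c != 0 -> d != 0 -> size l = (size pre + size post).+4 ->
  layer u (pre ++ d :: c :: post) (braid c d (size pre) psi) l =
  braid c d (size pre).+1 (layer u (pre ++ c :: d :: post) psi) l.
Proof. by case: l => //= a l u0 c0 d0 [sz_l]; apply: row_braid. Qed.

Definition rmat_up (c d : F) : F := sigma (q ^+ 4 * d / c) / sigma (q ^+ 4).

(* [braided A cs psi cs' psi'] : psi' arises from psi by a sequence of crossings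
   of neighbouring lines, and A is the product of their amplitudes when all
   lines point up. *)
Inductive braided : F -> seq F -> vstate -> seq F -> vstate -> Prop :=
  | Braided0 cs (psi psi' : vstate) of
      (forall l, size l = size cs -> psi l = psi' l) : braided 1 cs psi cs psi'
  | BraidedS A pre c d post psi cs' psi' of c != 0 & d != 0 &
      braided A (pre ++ d :: c :: post) (braid c d (size pre) psi) cs' psi' :
      braided (rmat_up c d * A) (pre ++ c :: d :: post) psi cs' psi'.

Lemma eq_braided A cs (psi1 psi : vstate) cs' psi' :
    (forall l, size l = size cs -> psi1 l = psi l) ->
  braided A cs psi cs' psi' -> braided A cs psi1 cs' psi'.
Proof.
move=> eq_psi br; elim: br psi1 eq_psi => {A cs psi cs' psi'}.
  by move=> cs psi psi' eq1 psi1 eq2; apply: Braided0 => l sz_l;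
     rewrite eq2 // eq1.
move=> A pre c d post psi cs' psi' c0 d0 _ IH psi1 eq1.
apply: BraidedS => //; apply: IH => l sz_l; apply: eq_braid => m sz_m.
by apply: eq1; rewrite sz_m sz_l !size_cat.
Qed.

(** An additional outer line meets the crossing columns with its horizontal part, and [layer_braid]
    lets each crossing through to the top. *)
Lemma braided_layer A u cs psi cs' psi' : u != 0 ->
  braided A cs psi cs' psi' ->
  braided A (wrap u cs) (layer u cs psi) (wrap u cs') (layer u cs' psi').
Proof.
move=> u0; elim=> {A cs psi cs' psi'}.
  by move=> cs psi psi' eq_psi; apply: Braided0 => l _; apply: eq_layer.
move=> A pre c d post psi cs' psi' c0 d0 _ IH.
have wrapE a b : wrap u (pre ++ a :: b :: post)
               = (u :: pre) ++ a :: b :: post ++ [:: u].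
  by rewrite /wrap -catA.
rewrite wrapE; apply: BraidedS => //; rewrite -wrapE.
apply: eq_braided IH => l sz_l; rewrite layer_braid //.
by rewrite sz_l /wrap /= !size_cat /= addn1 addnS addnS.
Qed.

Lemma braided_layers A us cs psi cs' psi' : all (fun u => u != 0) us ->
  braided A cs psi cs' psi' ->
  braided A (foldr wrap cs us) (layers us cs psi)
    (foldr wrap cs' us) (layers us cs' psi').
Proof.
by elim: us => //= u us IH /andP[u0 us0] br; apply: braided_layer => //; apply: IH.
Qed.

(** Arrows are conserved, so two upward arrows come from two upward arrows and the crossing acts as
    a scalar. *)
Lemma braid_up c d k m psi :
  braid c d k psi (nseq (k + m.+2) true) = rmat_up c d * psi (nseq (k + m.+2) true).
Proof.
elim: k psi => [|k IH] psi /=; last exact: IH.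
by rewrite !big_bool /rmat /rmat_up /= !mul0r !addr0.
Qed.

Lemma cap_up k m psi :
  cap k psi (nseq (k + m.+2) true) = psi (nseq (k + m) true).
Proof. by elim: k psi => [|k IH] psi //=; apply: IH. Qed.

Lemma braided_up A cs psi cs' psi' : braided A cs psi cs' psi' ->
  psi' (nseq (size cs') true) = A * psi (nseq (size cs) true).
Proof.
elim=> {A cs psi cs' psi'}.
  by move=> cs psi psi' eq_psi; rewrite mul1r eq_psi // size_nseq.
move=> A pre c d post psi cs' psi' _ _ _ ->.
by rewrite !size_cat /= braid_up; ring.
Qed.

(** Crossing the two lines on the left in one order, and on the right in the other order, produces
    the same state. Both crossings have the amplitude [rmat_up u w] on upward arrows, which is then
    cancelled. *)
Lemma Zvec_swap pre u w post x :
    all (fun u => u != 0) (pre ++ u :: w :: post) -> x != 0 ->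
    rmat_up u w != 0 ->
  Zvec (pre ++ u :: w :: post) x = Zvec (pre ++ w :: u :: post) x.
Proof.
rewrite all_cat => /and4P[pre0 u0 w0 post0] x0 r0.
set cs := cols post x; set psi := vec post x.
have cs0 : all (fun c => c != 0) cs.
  rewrite /cs; elim: (post) post0 => /= [|v p IH]; first by rewrite x0.
  by move=> /andP[v0 p0]; rewrite /= v0 all_cat IH //= v0.
have colsE a b : cols [:: a, b & post] x = a :: b :: cs ++ [:: b; a].
  by rewrite /cs /cols /= /wrap /= -catA.
pose Phi := braid u w 0 (layer u (wrap w cs) (layer w cs psi)).
(* A swap on the left of the columns for [u, w] and a swap on the right of those for [w, u] both
   lead to this order. *)
pose cs' := (w :: u :: cs) ++ [:: w; u].
have br1 : braided (rmat_up u w * 1) (cols [:: u, w & post] x)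
             (vec [:: u, w & post] x) cs' Phi.
  rewrite colsE.
  by apply: (@BraidedS _ [::]) => //; apply: Braided0.
have br2 : braided (rmat_up u w * 1) (cols [:: w, u & post] x)
             (vec [:: w, u & post] x) cs' Phi.
  rewrite colsE.
  apply: (@BraidedS _ (w :: u :: cs)) => //; apply: Braided0 => l sz_l.
  by symmetry; apply: layer_exchange => //; rewrite sz_l /= size_cat /= addn2.
have up (v1 v2 : F) : braided (rmat_up u w * 1) (cols [:: v1, v2 & post] x)
    (vec [:: v1, v2 & post] x) cs' Phi ->
    layers pre cs' Phi (nseq (size (foldr wrap cs' pre)) true)
    = rmat_up u w * Zvec (pre ++ v1 :: v2 :: post) x.
  move=> /(braided_layers pre0)/braided_up; rewrite mulr1 => ->.
  rewrite /Zvec /vec layers_cat -/(cols _ _) -/(vec _ _).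
  have -> : size (foldr wrap (cols [:: v1, v2 & post] x) pre)
          = (size (pre ++ [:: v1, v2 & post])).*2.+1 => //.
  by rewrite size_wraps size_cols size_cat /=; lia.
by apply: (mulfI r0); rewrite -(up _ _ br1) -(up _ _ br2).
Qed.

(** * U-turns and the recursion *)

Lemma row0 u cs h top : row u cs h top (fun=> 0) = 0.
Proof.
by rewrite -[RHS](mul0r (row u cs h top (fun=> 0))) -rowZ; apply: eq_row => l;
  rewrite mul0r.
Qed.

Lemma cap_sum k (I : finType) (f : I -> vstate) l :
  cap k (fun m => \sum_i f i m) l = \sum_i cap k (f i) l.
Proof.
elim: k f l => [|k IH] f [|x l] /=; rewrite ?big1_eq //.
by case: l => [|y l]; rewrite ?big1_eq //; case: eqP; rewrite ?big1_eq.
Qed.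

Lemma capZ k a (f : vstate) l : cap k (fun m => a * f m) l = a * cap k f l.
Proof.
elim: k f l => [|k IH] f [|x l] /=; rewrite ?mulr0 //.
by case: l => [|y l]; rewrite ?mulr0 //; case: eqP; rewrite ?mulr0.
Qed.

(** The line turns up before the two legs of the U-turn instead of behind them; its vertical part
    then crosses both legs. *)
Lemma row_cap_right u c d cs h top psi :
    u != 0 -> d != 0 -> c = (q ^+ 2 * d)^-1 -> size top = (size cs).+3 ->
  row u (cs ++ [:: c; d]) h top (cap (size cs) psi) =
  braid u d (size cs).+1 (braid u c (size cs)
    (cap (size cs).+1 (fun l => row u cs h l psi))) top.
Proof.
move=> u0 d0 cE; elim: cs h top psi => [|p cs IH] h [|t top] psi // [sz_top].
  case: top sz_top => [|z [|b []]] // _.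
  transitivity ((\sum_(e : bool) \sum_(k : bool)
     bulk (u * c) t e h k * bulk (u * d) z e k (~~ b)) * psi [::]).
    rewrite /= !big_bool /=; case: b => /=;
      rewrite ?(mulr0, addr0, add0r) //; ring.
  rewrite rmat_cap_right // /= !big_bool /=.
  by case: h => /=; rewrite ?(mulr0, addr0, add0r) //; ring.
transitivity (\sum_(s : bool) \sum_(e : bool) bulk (u * p) t s h e *
   braid u d (size cs).+1 (braid u c (size cs) (cap (size cs).+1
     (fun l => row u cs e l (fun m => psi (s :: m))))) top).
  by rewrite /=; do 2!apply: eq_bigr => ? _; congr (_ * _); apply: IH.
transitivity (braid u d (size cs).+1 (braid u c (size cs) (cap (size cs).+1
  (fun l => row u (p :: cs) h (t :: l) psi))) top); last by [].
symmetry; rewrite (@eq_braid u d _ _ (fun m => \sum_(s : bool) \sum_(e : bool)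
  bulk (u * p) t s h e * braid u c (size cs) (cap (size cs).+1
    (fun l => row u cs e l (fun m => psi (s :: m)))) m)); last first.
  move=> m _; rewrite (@eq_braid u c _ _ (fun m => \sum_(s : bool) \sum_(e : bool)
    bulk (u * p) t s h e * cap (size cs).+1
      (fun l => row u cs e l (fun m => psi (s :: m))) m)); last first.
    move=> m' _; rewrite [LHS]cap_sum; apply: eq_bigr => s _; rewrite cap_sum.
    by apply: eq_bigr => e _; rewrite capZ.
  rewrite braid_sum; apply: eq_bigr => s _; rewrite braid_sum.
  by apply: eq_bigr => e _; rewrite braidZ.
rewrite braid_sum; apply: eq_bigr => s _; rewrite braid_sum.
by apply: eq_bigr => e _; rewrite braidZ.
Qed.

Lemma layer_cap_right u c d cs psi l :
    u != 0 -> d != 0 -> c = (q ^+ 2 * d)^-1 -> size l = (size cs).+4 ->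
  layer u (cs ++ [:: c; d]) (cap (size cs) psi) l =
  braid u d (size cs).+2 (braid u c (size cs).+1
    (cap (size cs).+2 (layer u cs psi))) l.
Proof. by case: l => // a l u0 d0 cE [sz_l]; apply: row_cap_right. Qed.

Lemma layer_cap_left u c d cs psi l :
    u != 0 -> d != 0 -> c = q ^+ 2 / d -> size l = (size cs).+4 ->
  layer u (d :: c :: cs) (cap 0 psi) l =
  braid d u 0 (braid c u 1 (cap 0 (layer u cs psi))) l.
Proof.
case: l => [|a [|y [|z l]]] // u0 d0 cE _.
transitivity (\sum_(h : bool) (\sum_(e : bool) \sum_(k : bool)
   bulk (u * d) y e a k * bulk (u * c) z e k h) * row u cs h l psi).
  by rewrite /= !big_bool /= !row0; ring.
under eq_bigr => h _ do rewrite rmat_cap_left //.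
by rewrite /= !big_bool /=; ring.
Qed.

Lemma sigma1 : sigma (1 : F) = 0.
Proof. by rewrite /sigma invr1 subrr. Qed.

(** At label [q ^- 2] the only vertex joins its upper edge to the right one and its lower edge to
    the left one. With the right corner, the first connection becomes a U-turn of the last two
    columns; the second makes the left column the new central line. *)
Lemma layer_cap_base_right u c l : u != 0 -> c = (q ^+ 2 * u)^-1 -> size l = 3 ->
  layer u [:: c] (fun=> 1) l = cap 1 (fun=> 1) l.
Proof.
move=> u0 ->; case: l => [|a [|y [|b []]]] // _; rewrite /= !big_bool /bulk /=.
have -> : q ^+ 2 * (u * (q ^+ 2 * u)^-1) = 1 by field; rewrite ?q0 ?u0 ?oner_eq0.
have -> : q ^+ 2 * (u * (q ^+ 2 * u)^-1)^-1 = q ^+ 4 by field; rewrite ?q0 ?u0 ?oner_eq0.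
by case: a; case: y; case: b; rewrite /= ?sigma1 ?mulfV ?simp.
Qed.

(** At label [q ^+ 2] the upper edge is joined to the left one, which gives the mirror image. *)
Lemma layer_cap_base_left u c l : u != 0 -> c = q ^+ 2 / u -> size l = 3 ->
  layer u [:: c] (fun=> 1) l = cap 0 (fun=> 1) l.
Proof.
move=> u0 ->; case: l => [|a [|y [|b []]]] // _; rewrite /= !big_bool /bulk /=.
have -> : q ^+ 2 * (u * (q ^+ 2 / u)) = q ^+ 4 by field; rewrite ?q0 ?u0 ?oner_eq0.
have -> : q ^+ 2 * (u * (q ^+ 2 / u))^-1 = 1 by field; rewrite ?q0 ?u0 ?oner_eq0.
by case: a; case: y; case: b; rewrite /= ?sigma1 ?mulfV ?simp.
Qed.

(** The U-turn formed in the centre moves out to the right; the rising part of each line [u] in [us]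
    has to cross its two legs, which gives the two factors. *)
Lemma braided_cap_right us c d :
    all (fun u => u != 0) us -> d != 0 -> c = (q ^+ 2 * d)^-1 ->
  braided (\prod_(u <- us) (rmat_up u c * rmat_up u d))
    (cols us d ++ [:: c; d]) (cap (size us).*2.+1 (vec us d))
    (cols (rcons us d) c) (vec (rcons us d) c).
Proof.
move=> us0 d0 cE.
have c0 : c != 0 by rewrite cE invr_eq0 mulf_neq0 ?expf_neq0.
elim: us us0 => [_|u us IH /andP[u0 us0]].
  by rewrite big_nil; apply: Braided0 => l sz_l; rewrite [RHS]layer_cap_base_right.
rewrite big_cons -mulrA.
have {IH}/(braided_layer u0) IH := IH us0.
have -> : cols (u :: us) d ++ [:: c; d] = (u :: cols us d) ++ u :: c :: [:: d].
  by rewrite /cols /= -catA.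
apply: (@BraidedS _ (u :: cols us d) u c [:: d]) => //.
have -> : (u :: cols us d) ++ [:: c; u; d] = (u :: cols us d ++ [:: c]) ++ u :: d :: [::].
  by rewrite /= -catA.
apply: (@BraidedS _ (u :: cols us d ++ [:: c]) u d [::]) => //.
have -> : (u :: cols us d ++ [:: c]) ++ [:: d; u] = wrap u (cols us d ++ [:: c; d]).
  by rewrite /= /wrap -!catA.
apply: eq_braided IH => l sz_l.
rewrite -(size_cols us d) [RHS]layer_cap_right //.
  by rewrite /= size_cat addn1 size_cols.
by rewrite sz_l /wrap /= !size_cat /= addn1 addn2.
Qed.

Lemma braided_cap_left us c d :
    all (fun u => u != 0) us -> d != 0 -> c = q ^+ 2 / d ->
  braided (\prod_(u <- us) (rmat_up c u * rmat_up d u))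
    (d :: c :: cols us d) (cap 0 (vec us d))
    (cols (rcons us d) c) (vec (rcons us d) c).
Proof.
move=> us0 d0 cE.
have c0 : c != 0 by rewrite cE mulf_neq0 ?invr_eq0 ?expf_neq0.
elim: us us0 => [_|u us IH /andP[u0 us0]].
  by rewrite big_nil; apply: Braided0 => l sz_l; rewrite [RHS]layer_cap_base_left.
rewrite big_cons -mulrA.
have {IH}/(braided_layer u0) IH := IH us0.
apply: (@BraidedS _ [:: d]) => //.
apply: (@BraidedS _ [::]) => //=.
apply: eq_braided IH => l sz_l.
by rewrite [RHS]layer_cap_left // sz_l /wrap /= size_cat addn1.
Qed.

Lemma Zvec_cap_right us c d :
    all (fun u => u != 0) us -> d != 0 -> c = (q ^+ 2 * d)^-1 ->
  Zvec (rcons us d) c =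
  \prod_(u <- us) (rmat_up u c * rmat_up u d) * Zvec us d.
Proof.
move=> us0 d0 cE; have /braided_up := braided_cap_right us0 d0 cE.
by rewrite size_cat !size_cols cap_up addn0.
Qed.

Lemma Zvec_cap_left us c d :
    all (fun u => u != 0) us -> d != 0 -> c = q ^+ 2 / d ->
  Zvec (rcons us d) c =
  \prod_(u <- us) (rmat_up c u * rmat_up d u) * Zvec us d.
Proof.
move=> us0 d0 cE; have /braided_up := braided_cap_left us0 d0 cE.
by rewrite /= !size_cols.
Qed.

Lemma colsE us x : cols us x = us ++ x :: rev us.
Proof.
elim: us => //= u us ->; rewrite /wrap rev_cons -cats1 -catA.
by [].
Qed.

(** * Parity in the last parameter *)

Lemma sigmaN (x : F) : sigma (- x) = - sigma x.
Proof. by rewrite /sigma invrN opprB opprK addrC. Qed.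

Lemma bulkN u n s w e :
  bulk (- u) n s w e = (-1) ^+ (~~ (n (+) s)) * bulk u n s w e.
Proof.
by case: n; case: s; case: w; case: e;
  rewrite /bulk /= ?invrN ?mulrN ?sigmaN ?mulNr ?expr0 ?expr1 ?mulN1r ?simp ?oppr0.
Qed.

(** A vertex conserves arrows modulo 2, so two signs need to agree only in the states with
    [n (+) s = w (+) e]. *)
Lemma bulk_sign u n s w e (a b : bool) (r : F) :
    (n (+) s = w (+) e -> a = b) ->
  bulk u n s w e * ((-1) ^+ a * r) = (-1) ^+ b * (bulk u n s w e * r).
Proof.
move=> ab; have [/ab->|] := eqVneq (n (+) s) (w (+) e); first by rewrite mulrCA.
by case: n s w e {ab} => [] [] [] [] // _; rewrite /bulk /= !simp.
Qed.

Lemma row_sign u cs h top (psi : vstate) :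
  row u cs h top (fun l => (-1) ^+ odd (count id l) * psi l) =
  (-1) ^+ (odd (count id top) (+) ~~ h) * row u cs h top psi.
Proof.
elim: cs h top psi => [|c cs IH] h [|t top] psi /=; rewrite ?mulr0 //.
  by case: top => [|? ?]; rewrite ?mulr0 //; case: h; case: t; rewrite /= ?simp.
rewrite mulr_sumr; apply: eq_bigr => s _; rewrite mulr_sumr; apply: eq_bigr => e _.
rewrite (@eq_row u cs e top _ (fun l =>
  (-1) ^+ s * ((-1) ^+ odd (count id l) * psi (s :: l)))); last first.
  by move=> l _; rewrite mulrA -signr_addb oddD oddb.
rewrite rowZ IH [(-1) ^+ s * _]mulrA -signr_addb; apply: bulk_sign.
by rewrite oddD oddb; case: t; case: s; case: h; case: e; case: odd.
Qed.

Definition offmid (k : nat) (l : seq bool) : bool := odd (count id l) (+) nth false l k.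

(** The change of sign of [x] puts a sign on a straight vertex of the central column; conservation
    of arrows modulo 2 expresses it by bits above and below the row, so that the signs of successive
    rows telescope. *)
Lemma row_offmid u pre x post h top (psi : vstate) :
  size top = (size pre + size post).+2 ->
  row u (pre ++ - x :: post) h top (fun l => (-1) ^+ offmid (size pre) l * psi l) =
  (-1) ^+ (offmid (size pre) top (+) h) * row u (pre ++ x :: post) h top psi.
Proof.
elim: pre h top psi => [|c cs IH] h [|t top] psi //= [sz_top].
  rewrite mulr_sumr; apply: eq_bigr => s _.
  rewrite mulr_sumr; apply: eq_bigr => e _.
  rewrite (@eq_row u post e top _ (fun l =>
    (-1) ^+ odd (count id l) * psi (s :: l))); last first.
    by move=> l _; rewrite /offmid /= oddD oddb addbC addKb.
  rewrite row_sign mulrN bulkN mulrACA -signr_addb [LHS]mulrCA.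
  apply: bulk_sign.
  rewrite /offmid /= oddD oddb.
  by case: t; case: s; case: h; case: e; case: odd.
rewrite mulr_sumr; apply: eq_bigr => s _; rewrite mulr_sumr; apply: eq_bigr => e _.
rewrite (@eq_row u _ e top _ (fun l =>
  (-1) ^+ s * ((-1) ^+ offmid (size cs) l * psi (s :: l)))); last first.
  by move=> l _; rewrite mulrA -signr_addb /offmid /= oddD oddb addbA.
rewrite rowZ IH // [(-1) ^+ s * _]mulrA -signr_addb; apply: bulk_sign.
rewrite /offmid /= oddD oddb.
by case: t; case: s; case: h; case: e; case: odd; case: nth.
Qed.

Lemma vecN us x l : size l = (size us).*2.+1 ->
  vec us (- x) l = (-1) ^+ offmid (size us) l * vec us x l.
Proof.
elim: us l => [|u us IH] l.
  by case: l => [|a []] // _; rewrite /vec /offmid /=; case: a; rewrite /= ?simp.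
case: l => // a l [sz_l]; rewrite /vec /= -/(cols _ _) -/(cols _ _).
rewrite -/(vec us x) -/(vec us (- x)).
rewrite (@eq_row u _ a l _ (fun l => (-1) ^+ offmid (size us) l * vec us x l)).
  rewrite !colsE row_offmid ?size_rev ?sz_l //; last by rewrite addnn doubleS.
  by congr (_ * _); rewrite /offmid /= oddD oddb; case: a; case: odd; case: nth.
by move=> m; rewrite size_cols => /IH.
Qed.

Lemma ZvecN us x : Zvec us (- x) = Zvec us x.
Proof.
rewrite /Zvec vecN ?size_nseq // /offmid nth_nseq count_nseq mul1n /= odd_double.
by rewrite -addnn ltnS leq_addr mul1r.
Qed.

(** * Interpolation in the last parameter *)

(* f is a Laurent polynomial with exponents in [-d, d]. *)
Definition laurent (d : nat) (f : F -> F) : Prop :=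
  exists2 p : {poly F}, (size p <= d.*2.+1)%N &
    forall x, x != 0 -> f x * x ^+ d = p.[x].

Lemma eq_laurent d (f g : F -> F) :
  (forall x, x != 0 -> g x = f x) -> laurent d f -> laurent d g.
Proof. by move=> fg [p sz_p fE]; exists p => // x x0; rewrite fg ?fE. Qed.

Lemma laurent_le d e f : (d <= e)%N -> laurent d f -> laurent e f.
Proof.
move=> le_de [p sz_p fE]; exists (p * 'X^(e - d)) => [|x x0].
  by apply: leq_trans (size_polyMleq _ _) _; rewrite size_polyXn; lia.
by rewrite hornerM hornerXn -fE // -mulrA -exprD subnKC.
Qed.

Lemma laurentC c : laurent 0 (fun=> c).
Proof.
by exists c%:P => [|x _]; rewrite ?size_polyC_leq1 // hornerC mulr1.
Qed.

Lemma laurentD d f g : laurent d f -> laurent d g -> laurent d (fun x => f x + g x).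
Proof.
move=> [p sz_p fE] [r sz_r gE]; exists (p + r) => [|x x0].
  by apply: leq_trans (size_polyD _ _) _; rewrite geq_max sz_p.
by rewrite hornerD mulrDl fE ?gE.
Qed.

Lemma laurentM d e f g :
  laurent d f -> laurent e g -> laurent (d + e) (fun x => f x * g x).
Proof.
move=> [p sz_p fE] [r sz_r gE]; exists (p * r) => [|x x0].
  by apply: leq_trans (size_polyMleq _ _) _; lia.
by rewrite hornerM exprD mulrACA fE ?gE.
Qed.

Lemma laurentZ d c f : laurent d f -> laurent d (fun x => c * f x).
Proof. exact: (laurentM (laurentC c)). Qed.

Lemma laurent_sum (I : Type) (r : seq I) (P : pred I) d (f : I -> F -> F) :
  (forall i, P i -> laurent d (f i)) -> laurent d (fun x => \sum_(i <- r | P i) f i x).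
Proof.
move=> lf; elim: r => [|i r IH].
  apply: (laurent_le (leq0n d)); apply: eq_laurent (laurentC 0) => x _.
  by rewrite big_nil.
case: (boolP (P i)) => Pi; last first.
  by apply: eq_laurent IH => x _; rewrite big_cons (negbTE Pi).
by apply: eq_laurent (laurentD (lf i Pi) IH) => x _; rewrite big_cons Pi.
Qed.

Lemma laurent_prod (I : Type) (r : seq I) d (f : I -> F -> F) :
  (forall i, laurent d (f i)) ->
  laurent (d * size r) (fun x => \prod_(i <- r) f i x).
Proof.
move=> lf; elim: r => [|i r IH].
  by rewrite muln0; apply: eq_laurent (laurentC 1) => x _; rewrite big_nil.
by rewrite /= mulnS; apply: eq_laurent (laurentM (lf i) IH) => x _; rewrite big_cons.
Qed.

Lemma laurent_sigma (c : F) : laurent 1 (fun x => sigma (c * x)).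
Proof.
exists (c *: 'X^2 - c^-1%:P) => [|x x0].
  apply: leq_trans (size_polyD _ _) _; rewrite geq_max size_polyN.
  rewrite (leq_trans (size_scale_leq _ _)) ?size_polyXn //.
  by rewrite (leq_trans (size_polyC_leq1 _)).
rewrite hornerD hornerZ hornerXn hornerN hornerC /sigma expr1 mulrBl invfM.
by rewrite mulfVK // -mulrA.
Qed.

Lemma laurent_sigmaV (c : F) : laurent 1 (fun x => sigma (c * x^-1)).
Proof.
apply: eq_laurent (laurentZ (-1) (laurent_sigma c^-1)) => x x0.
by rewrite -[c * x^-1]invrK invfM invrK /sigma invrK; ring.
Qed.

Lemma laurent_eq0 d f (rs : seq F) : laurent d f -> uniq rs -> (d.*2 < size rs)%N ->
    (forall r, r \in rs -> r != 0 /\ f r = 0) ->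
  forall x, x != 0 -> f x = 0.
Proof.
move=> [p sz_p fE] rs_uniq sz_rs rs0 x x0.
have p0 : p = 0.
  apply/eqP/negPn/negP => p_neq0.
  have rt : all (root p) rs.
    by apply/allP => r /rs0[r0 fr0]; rewrite rootE -fE // fr0 mul0r.
  by have := max_poly_roots p_neq0 rt rs_uniq; rewrite ltnNge (leq_trans sz_p).
by apply/eqP; rewrite -(mulIr_eq0 _ (mulIf (expf_neq0 d x0))) fE // p0 horner0.
Qed.

Lemma laurent_bulk u n s w e : laurent 1 (fun x => bulk (u * x) n s w e).
Proof.
rewrite /bulk; case: eqP => _; last exact: (laurent_le _ (laurentC _)).
case: eqP => _; last exact: (laurent_le _ (laurentC _)).
case: eqP => _.
  apply: eq_laurent (laurentZ (sigma (q ^+ 4))^-1 (laurent_sigma (q ^+ 2 * u))) => x _.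
  by rewrite mulrC mulrA.
apply: eq_laurent (laurentZ (sigma (q ^+ 4))^-1 (laurent_sigmaV (q ^+ 2 / u))) => x _.
by rewrite mulrC invfM mulrA.
Qed.

Lemma laurent_row0 d u cs h top (psi : F -> vstate) :
  (forall l, laurent d (psi^~ l)) -> laurent d (fun x => row u cs h top (psi x)).
Proof.
have l0 : laurent d (fun=> 0) by apply: laurent_le (laurentC 0).
move=> lpsi; elim: cs h top psi lpsi => [|c cs IH] h [|t top] psi lpsi //=.
  by case: top => // ; case: eqP.
by do 2!apply: laurent_sum => ? _; apply: laurentZ; apply: IH.
Qed.

Lemma laurent_row d u pre post h top (psi : F -> vstate) :
  (forall l, laurent d (psi^~ l)) ->
  laurent d.+1 (fun x => row u (pre ++ x :: post) h top (psi x)).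
Proof.
have l0 : laurent d.+1 (fun=> 0) by apply: laurent_le (laurentC 0).
move=> lpsi; elim: pre h top psi lpsi => [|c pre IH] h [|t top] psi lpsi //=;
  do 2!apply: laurent_sum => ? _.
  rewrite -add1n; apply: laurentM; first exact: laurent_bulk.
  exact: laurent_row0.
by apply: laurentZ; apply: IH.
Qed.

(** Each line meets the central column in one vertex, which raises the degree by at most 1. *)
Lemma laurent_Zvec us : laurent (size us) (Zvec us).
Proof.
rewrite /Zvec; move: (nseq _ _); elim: us => [|u us IH] l.
  exact: laurentC.
rewrite /vec /=; case: l => [|a l] /=; first exact: (laurent_le _ (laurentC _)).
rewrite -/(cols _ _).
have := laurent_row u us (rev us) a l (psi := vec us) IH.
by apply: eq_laurent => x _; rewrite -colsE.
Qed.

Lemma sigmaV (x : F) : sigma x^-1 = - sigma x.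
Proof. by rewrite /sigma invrK opprB. Qed.

Lemma sigma_eq0 (x : F) : x != 0 -> (sigma x == 0) = (x ^+ 2 == 1).
Proof.
by move=> x0; rewrite /sigma subr_eq0 -(inj_eq (mulIf x0)) mulVf // expr2.
Qed.

(** Invariance is assumed only at rearrangements of [us], because the swaps to which this is applied
    depend on genericity or on the number of parameters. *)
Lemma swap_move (T : eqType) X (f : seq T -> X) us :
    (forall pre x y post, perm_eq us (pre ++ x :: y :: post) ->
       f (pre ++ x :: y :: post) = f (pre ++ y :: x :: post)) ->
  forall pre x mid post, perm_eq us (pre ++ x :: mid ++ post) ->
  f (pre ++ x :: mid ++ post) = f (pre ++ mid ++ x :: post).
Proof.
move=> f_swap pre x mid; elim: mid pre => // y mid IH pre post us_p.
rewrite f_swap // -[pre ++ y :: _]cat_rcons IH cat_rcons //.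
apply: perm_trans us_p _; rewrite perm_cat2l /=.
by apply/seq.permP => p /=; rewrite addnCA.
Qed.

(** * Prefactor and Pfaffian as functions of a list *)

Definition gfac (x y : F) : F :=
  sigma (q ^+ 2 * x * y) * sigma (q ^+ 2 * x^-1 * y^-1).

Lemma gfacC x y : gfac x y = gfac y x.
Proof. by rewrite /gfac mulrAC; congr (_ * sigma _); rewrite mulrAC. Qed.

Fixpoint pref (us : seq F) : F :=
  if us is x :: us' then \prod_(y <- us') (gfac x y / sigma (x * y^-1)) * pref us'
  else 1.

(** [gfac] is symmetric, while [sigma (x / y)] changes sign; this sign compensates that of the
    Pfaffian. *)
Lemma pref_swap pre x y post :
  pref (pre ++ x :: y :: post) = - pref (pre ++ y :: x :: post).
Proof.
elim: pre => [|z pre IH] /=.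
  rewrite !big_cons; have -> : sigma (x * y^-1) = - sigma (y * x^-1).
    by rewrite -sigmaV invfM invrK mulrC.
  by rewrite (gfacC x y) invrN mulrN; ring.
by rewrite IH mulrN; congr (- (_ * _)); rewrite !big_cat !big_cons /= [X in _ * X]mulrCA.
Qed.

Lemma pref_move pre x post :
  pref (pre ++ x :: post) = (-1) ^+ size pre * pref (x :: pre ++ post).
Proof.
elim/last_ind: pre post => [|pre y IH] post; first by rewrite mul1r.
rewrite cat_rcons pref_swap IH size_rcons exprS -cat_rcons mulN1r mulNr.
by rewrite cat_rcons.
Qed.

Section Interpolation.
Hypothesis charF : [pchar F] =i pred0.
Variables (kappa : F -> F -> F) (e : seq (option F)).
Hypothesis kappaC : forall x y, kappa x y = kappa y x.

(* The two Pfaffians differ in the factor kappa and in the additional index None,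
   which is the index 2m in Q. *)
Definition entry (o o' : option F) : F :=
  match o, o' with
  | Some x, Some y => kappa x y * sigma (x * y^-1) / gfac x y
  | Some _, None => 1
  | None, Some _ => -1
  | None, None => 0
  end.

Lemma entryN o o' : entry o o' = - entry o' o.
Proof.
case: o o' => [x|] [y|] //=; rewrite ?opprK ?oppr0 //.
rewrite kappaC gfacC -mulNr -mulrN; congr (_ * _ / _).
by rewrite -sigmaV invfM invrK mulrC.
Qed.

Definition pf_list (us : seq F) : F := pfl None entry (map Some us ++ e).

Definition rhs (us : seq F) : F := pref us * pf_list us.

Lemma rhs_swap pre x y post : ~~ odd (size pre + size post + size e) ->
  rhs (pre ++ x :: y :: post) = rhs (pre ++ y :: x :: post).
Proof.
move=> even_s; rewrite /rhs pref_swap /pf_list !map_cat /= -!catA /=.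
rewrite pfl_swap ?mulrNN //; first exact: entryN.
by rewrite size_cat !size_map addnA.
Qed.

Lemma rhs_move pre u post : ~~ odd (size (pre ++ u :: post) + size e) ->
  rhs (pre ++ u :: post) = rhs (rcons (pre ++ post) u).
Proof.
move=> even_s; rewrite -cats1 -catA -[u :: post](cats0 (u :: post)) cat_cons.
apply: (@swap_move _ _ rhs (pre ++ u :: post)); last by rewrite cats0.
move=> pre' y z post' /perm_size sz; apply: rhs_swap.
by move: even_s; rewrite sz size_cat /=; lia.
Qed.

Lemma rhs_rcons us x : odd (size us + size e) -> rhs (x :: us) = rhs (rcons us x).
Proof. by move=> odd_s; rewrite (@rhs_move [::]) //= odd_s. Qed.

Definition del (j : nat) (us : seq F) := take j us ++ drop j.+1 us.

(* [numer us x] is the product of the [gfac x y] for y in us times the Pfaffian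
   with first index x, as a polynomial expression in x. *)
Definition numer (us : seq F) (x : F) : F :=
  \sum_(j < size us) (-1) ^+ j * kappa x (nth 0 us j) * sigma (x * (nth 0 us j)^-1) *
     \prod_(y <- del j us) gfac x y * pf_list (del j us)
  + (if e is [::] then 0 else
      (-1) ^+ size us * \prod_(y <- us) gfac x y * pfl None entry (map Some us)).

Hypothesis eE : e = [::] \/ e = [:: None].

Lemma prod_del j us (f : F -> F) : (j < size us)%N ->
  \prod_(y <- us) f y = f (nth 0 us j) * \prod_(y <- del j us) f y.
Proof.
move=> lt_j; rewrite -{1}(cat_take_drop j us) (drop_nth 0 lt_j) /del.
by rewrite !big_cat big_cons /= mulrCA.
Qed.

Lemma numerE us x : odd (size us + size e) -> all (fun y => gfac x y != 0) us ->
  numer us x = \prod_(y <- us) gfac x y * pf_list (x :: us).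
Proof.
move=> odd_s /allP g0; rewrite /pf_list /= pfl_cons; last by rewrite size_cat size_map.
rewrite size_cat size_map big_split_ord /= mulrDr; congr (_ + _).
  rewrite mulr_sumr; apply: eq_bigr => j _.
  rewrite nth_cat size_map ltn_ord (nth_map 0) // (prod_del _ (ltn_ord j)).
  rewrite take_cat drop_cat size_map ltn_ord.
  have -> : take j (map Some us) ++ (if (j.+1 < size us)%N then drop j.+1 (map Some us) ++ e
      else drop (j.+1 - size us) e) = map Some (del j us) ++ e.
    rewrite /del map_cat map_take map_drop -catA; congr (_ ++ _).
    case: ltnP => // le_j; have -> : (j.+1 - size us = 0)%N by have := ltn_ord j; lia.
    by rewrite drop0 [drop _ _]drop_oversize // size_map.
  rewrite -/(pf_list _) /=; field.
  by apply: g0; rewrite mem_nth.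
case: eE odd_s => ->; first by rewrite big_ord0 mulr0.
move=> odd_s; rewrite big_ord1 /= addn0 nth_cat size_map ltnn subnn /= mulr1.
rewrite take_cat drop_cat size_map ltnn subnn take0 cats0.
rewrite ltnNge leqnSn /= subSnn cats0.
by rewrite mulrA [X in X * _]mulrC.
Qed.

Lemma laurent_gfac y : laurent 2 (gfac^~ y).
Proof.
apply: eq_laurent (laurentM (laurent_sigma (q ^+ 2 * y)) (laurent_sigmaV (q ^+ 2 / y))).
by move=> x _; rewrite /gfac mulrAC [_ / y]mulrAC.
Qed.

Lemma gfacN x y : gfac (- x) y = gfac x y.
Proof. by rewrite /gfac invrN !(mulrN, mulNr) !sigmaN mulrNN. Qed.

Hypothesis laurent_kappa : forall y, laurent 1 (kappa^~ y).
Hypothesis kappaN : forall x y, kappa (- x) y = (-1) ^+ size e * kappa x y.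

Lemma size_del j us : (j < size us)%N -> size (del j us) = (size us).-1.
Proof. by move=> lt_j; rewrite size_cat size_takel ?size_drop; lia. Qed.

Lemma laurent_numer us : (0 < size us)%N -> laurent (size us).*2 (numer us).
Proof.
move=> us_gt0; have lprod us' : laurent (size us').*2 (fun x => \prod_(y <- us') gfac x y).
  by rewrite -mul2n; apply: laurent_prod => y; apply: laurent_gfac.
apply: laurentD.
  apply: laurent_sum => j _.
  have lj : laurent (1 + 1 + (size us).-1.*2)
     (fun x => kappa x (nth 0 us j) * sigma (x * (nth 0 us j)^-1) *
               \prod_(y <- del j us) gfac x y).
    rewrite -(size_del (ltn_ord j)); apply: laurentM; last exact: lprod.
    apply: laurentM; first exact: laurent_kappa.
    by apply: eq_laurent (laurent_sigma (nth 0 us j)^-1) => x _; rewrite mulrC.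
  have -> : ((size us).*2 = 1 + 1 + (size us).-1.*2)%N by lia.
  apply: eq_laurent (laurentZ ((-1) ^+ j * pf_list (del j us)) lj) => x _; ring.
case: (e) => [|_ _]; first exact: (laurent_le _ (laurentC 0)).
apply: eq_laurent (laurentZ ((-1) ^+ size us * pfl None entry (map Some us)) (lprod us)).
by move=> x _; ring.
Qed.

Lemma prod_gfacN us x : \prod_(y <- us) gfac (- x) y = \prod_(y <- us) gfac x y.
Proof. by apply: eq_bigr => y _; rewrite gfacN. Qed.

(** [gfac] is even and [sigma] is odd, and the parity of [kappa] is that of [size e], so all terms
    have the same parity. *)
Lemma numerN us x : odd (size us + size e) ->
  numer us (- x) = (-1) ^+ size us * numer us x.
Proof.
move=> odd_s; rewrite /numer mulrDr; congr (_ + _).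
  rewrite mulr_sumr; apply: eq_bigr => j _; rewrite prod_gfacN kappaN mulNr sigmaN.
  rewrite -(signr_odd _ (size us)) -(signr_odd _ (size e)).
  have -> : odd (size us) = ~~ odd (size e) by lia.
  by rewrite signrN; ring.
rewrite prod_gfacN; case: eE odd_s => ->; rewrite ?mulr0 //= addn1 /= => even_s.
by rewrite -(signr_odd _ (size us)) (negbTE even_s) !mul1r.
Qed.

(** Distinct squares keep [sigma (x / y)] away from 0. The next two conditions do this for [gfac],
    and at [x = y] for the boundary weights; the last one does it for [rmat_up]. Together they keep
    the interpolation points distinct. *)
Record generic (us : seq F) : Prop := Generic {
  generic_neq0 : {in us, forall x, x != 0};
  generic_sqr : uniq [seq x ^+ 2 | x <- us];
  generic_mul : {in us &, forall x y, q ^+ 4 * (x * y) ^+ 2 != 1};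
  generic_mulV : {in us &, forall x y, (x * y) ^+ 2 != q ^+ 4};
  generic_div : {in us &, forall x y, x ^+ 2 != q ^+ 8 * y ^+ 2}
}.

Lemma generic_sub us us' : generic us -> {subset us' <= us} ->
  uniq [seq x ^+ 2 | x <- us'] -> generic us'.
Proof.
case=> g1 g2 g3 g4 g5 sub uniq'; split=> // [x /sub|x y /sub xus /sub|x y /sub xus /sub|
  x y /sub xus /sub]; by [apply: g1 | apply: g3 | apply: g4 | apply: g5].
Qed.

Lemma generic_perm us us' : perm_eq us us' -> generic us -> generic us'.
Proof.
move=> us_us' gus; apply: (generic_sub gus) => [x|]; first by rewrite (perm_mem us_us').
by rewrite -(perm_uniq (perm_map _ us_us')) (generic_sqr gus).
Qed.

Lemma generic_subseq us us' : subseq us' us -> generic us -> generic us'.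
Proof.
move=> us_us' gus; apply: (generic_sub gus); first exact: mem_subseq.
exact: subseq_uniq (map_subseq _ us_us') (generic_sqr gus).
Qed.

Lemma generic_gfac us x y : generic us -> x \in us -> y \in us -> gfac x y != 0.
Proof.
move=> gus xus yus; have x0 := generic_neq0 gus xus; have y0 := generic_neq0 gus yus.
rewrite /gfac mulf_neq0 // sigma_eq0 ?mulf_neq0 ?invr_eq0 ?expf_neq0 //.
  have := generic_mul gus xus yus; apply: contra => /eqP <-; apply/eqP; ring.
have := generic_mulV gus xus yus; apply: contra => /eqP h; apply/eqP.
transitivity ((x * y) ^+ 2 * (q ^+ 2 * x^-1 * y^-1) ^+ 2); first by rewrite h mulr1.
by field; rewrite ?q0 ?x0 ?y0.
Qed.

Lemma generic_sigma us x y : generic us -> x \in us -> y \in us ->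
  x ^+ 2 != y ^+ 2 -> sigma (x * y^-1) != 0.
Proof.
move=> gus xus yus xy; have x0 := generic_neq0 gus xus; have y0 := generic_neq0 gus yus.
rewrite sigma_eq0 ?mulf_neq0 ?invr_eq0 //; apply: contra xy => /eqP h.
by rewrite -(divfK (expf_neq0 2 y0) (x ^+ 2)) -expr_div_n h mul1r.
Qed.

Lemma generic_rmat_up us x y : generic us -> x \in us -> y \in us -> rmat_up x y != 0.
Proof.
move=> gus xus yus; have x0 := generic_neq0 gus xus; have y0 := generic_neq0 gus yus.
rewrite /rmat_up mulf_neq0 ?invr_eq0 // sigma_eq0 ?mulf_neq0 ?invr_eq0 ?expf_neq0 //.
have := generic_div gus xus yus; apply: contra => /eqP h; apply/eqP.
transitivity (x ^+ 2 * (q ^+ 4 * y / x) ^+ 2); first by rewrite h mulr1.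
by field; rewrite ?q0 ?x0 ?y0.
Qed.

Lemma Zvec_move pre u post x : generic (pre ++ u :: post) -> x != 0 ->
  Zvec (pre ++ u :: post) x = Zvec (rcons (pre ++ post) u) x.
Proof.
move=> gus x0; rewrite -cats1 -catA -[u :: post](cats0 (u :: post)) cat_cons.
apply: (@swap_move _ _ (Zvec^~ x) (pre ++ u :: post)); last by rewrite cats0.
move=> pre' v w post' /generic_perm/(_ gus) gus'.
apply: Zvec_swap => //; first by apply/allP; apply: generic_neq0.
by apply: (generic_rmat_up gus'); rewrite mem_cat !inE eqxx !orbT.
Qed.

Lemma mem_del us j k : (j < size us)%N -> (k < size us)%N -> k != j ->
  nth 0 us k \in del j us.
Proof.
move=> lt_j lt_k kj; rewrite mem_cat; have [lt_kj|le_jk] := ltnP k j.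
  by rewrite -(nth_take 0 lt_kj) mem_nth // size_takel // ltnW.
have lt_jk : (j < k)%N by lia.
have -> : nth 0 us k = nth 0 (drop j.+1 us) (k - j.+1).
  by rewrite nth_drop subnKC.
by rewrite [X in _ || X]mem_nth ?orbT // size_drop ltn_sub2r // (leq_ltn_trans _ lt_k).
Qed.

Lemma prod_gfac0 us u x : u \in us -> gfac x u = 0 -> \prod_(y <- us) gfac x y = 0.
Proof. by move=> u_us g0; rewrite (big_rem u) //= g0 mul0r. Qed.

(** Every product that contains [gfac x u] vanishes, and only the term that pairs [x] with [u] omits
    this factor. *)
Lemma numer_at pre u post x : gfac x u = 0 ->
  numer (pre ++ u :: post) x =
  (-1) ^+ size pre * kappa x u * sigma (x * u^-1) *
    \prod_(y <- pre ++ post) gfac x y * pf_list (pre ++ post).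
Proof.
move=> g0; set us := pre ++ u :: post.
have lt_k : (size pre < size us)%N by rewrite size_cat addnS ltnS leq_addr.
have nth_k : nth 0 us (size pre) = u by rewrite nth_cat ltnn subnn.
have del_k : del (size pre) us = pre ++ post.
  by rewrite /del /us take_size_cat // -cat_rcons drop_size_cat // size_rcons.
have u_us : u \in us by rewrite mem_cat inE eqxx orbT.
rewrite /numer (bigD1 (Ordinal lt_k)) //= nth_k del_k (prod_gfac0 u_us g0).
rewrite [X in _ + X + _]big1 => [|j kj]; last first.
  rewrite (prod_gfac0 (u := u)) ?(mulr0, mul0r) //.
  by rewrite -[X in X \in _]nth_k mem_del // eq_sym.
by rewrite mulr0 mul0r; case: (e); rewrite !addr0.
Qed.

Lemma prod_mid pre u post (f : F -> F) :
  \prod_(y <- pre ++ u :: post) f y = f u * \prod_(y <- pre ++ post) f y.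
Proof. by rewrite !big_cat big_cons /= mulrCA. Qed.

(** Treats the two kinds of special points together: [r] is the amplitude of the crossings with the
    U-turn, [w] the factor without [x], and [c], [c'] are the normalizations before and after the
    reduction. The sign of moving [u] to the front of [pref] cancels the one in the expansion of the
    Pfaffian. *)
Lemma special_root pre u post x c c' w (r : F -> F) :
    generic (pre ++ u :: post) -> x != 0 ->
    Zvec (rcons (pre ++ post) u) x =
      \prod_(y <- pre ++ post) r y * Zvec (pre ++ post) u ->
    {in pre ++ post, forall y, r y * sigma (q ^+ 4) ^+ 2 * sigma (x * y^-1) =
      gfac u y / sigma (u * y^-1) * gfac x y} ->
    gfac x u = 0 ->
    Zvec (pre ++ post) u = c' * rhs (pre ++ post) * w ->
    c' = c * kappa x u * sigma (q ^+ 4) ^+ 2 ^+ size (pre ++ post) ->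
  Zvec (pre ++ u :: post) x * \prod_(y <- pre ++ u :: post) sigma (x * y^-1) =
  c * pref (pre ++ u :: post) * w * numer (pre ++ u :: post) x.
Proof.
move=> gus x0 Zx rE g0 Zu c'E.
rewrite Zvec_move // Zx Zu numer_at // pref_move prod_mid /=.
have prodE : \prod_(y <- pre ++ post) r y * sigma (q ^+ 4) ^+ 2 ^+ size (pre ++ post) *
    \prod_(y <- pre ++ post) sigma (x * y^-1) =
    \prod_(y <- pre ++ post) (gfac u y / sigma (u * y^-1)) *
    \prod_(y <- pre ++ post) gfac x y.
  have -> : sigma (q ^+ 4) ^+ 2 ^+ size (pre ++ post) =
      \prod_(y <- pre ++ post) sigma (q ^+ 4) ^+ 2.
    by rewrite big_const_seq count_predT -Monoid.iteropE.
  rewrite -!big_split /=; apply: eq_big_seq => y /rE <-.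
  by rewrite mulrAC.
rewrite c'E /rhs; set S := _ ^+ size (pre ++ post) in prodE *; set pi := \prod_(y <- _) (gfac u y / _).
set pg := \prod_(y <- _) gfac x y; rewrite -/pi -/pg in prodE.
transitivity (c * kappa x u * sigma (x * u^-1) * pref (pre ++ post) *
  pf_list (pre ++ post) * w * (pi * pg)); first by rewrite -prodE; ring.
have := sqrr_sign F (size pre); set sg := (-1) ^+ size pre => sg2.
by rewrite -[LHS]mul1r -{1}sg2; ring.
Qed.

Let two0 : (2 : F) != 0.
Proof. by move/GRing.pcharf0P: charF => ->. Qed.

Lemma neqN (x : F) : x != 0 -> x != - x.
Proof. by move=> x0; rewrite -addr_eq0 -mulr2n -mulr_natl mulf_neq0. Qed.

Let q8' : q ^+ 8 != 1.
Proof.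
apply: contra s40 => /eqP h; rewrite sigma_eq0 ?expf_neq0 //.
by rewrite -exprM h.
Qed.

(** These are the zeros of [gfac^~ u]. The recursion handles [q ^- 2 / u] and [q ^+ 2 / u], parity
    in [x] their negatives. *)
Definition special_points (us : seq F) : seq F :=
  [seq c * u^-1 | c <- [:: q ^- 2; - q ^- 2; q ^+ 2; - q ^+ 2], u <- us].

Lemma special_pointP us y : y \in special_points us ->
  exists2 u, u \in us & exists c, [/\ y = c * u^-1,
    c = q ^- 2 \/ c = - q ^- 2 \/ c = q ^+ 2 \/ c = - q ^+ 2 &
    c ^+ 2 = q ^- 4 \/ c ^+ 2 = q ^+ 4].
Proof.
rewrite /special_points => /allpairsP[[c u] [/= cin uin ->]]; exists u => //; exists c.
have q2 : (q ^- 2) ^+ 2 = q ^- 4 by rewrite exprVn -exprM.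
move: cin; rewrite !inE => /or4P[]/eqP->; split; auto;
  by rewrite ?sqrrN ?q2 -?exprM; auto.
Qed.

Lemma uniq_special_points us u0 : generic us -> u0 \in us ->
  uniq (u0 :: special_points us).
Proof.
move=> gus u0_us; rewrite cons_uniq; apply/andP; split.
  apply/negP => /special_pointP[u u_us [c [u0E _ c2]]].
  have uu0 := generic_neq0 gus u_us.
  have cE : c ^+ 2 = (u0 * u) ^+ 2 by rewrite u0E mulfVK.
  case: c2; rewrite cE => h; last by have := generic_mulV gus u0_us u_us; rewrite h eqxx.
  by have := generic_mul gus u0_us u_us; rewrite h mulfV ?eqxx // expf_neq0.
have q2 : q ^- 2 != 0 by rewrite invr_eq0 expf_neq0.
have q2' : q ^+ 2 != 0 by rewrite expf_neq0.
have sq : (q ^- 2) ^+ 2 != (q ^+ 2) ^+ 2.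
  apply: contra q8' => /eqP h; apply/eqP.
  transitivity ((q ^+ 2) ^+ 2 * (q ^+ 2) ^+ 2); first ring.
  by rewrite -{1}h; field.
have us_uniq : uniq us by apply: map_uniq (generic_sqr gus).
apply: allpairs_uniq => //.
  rewrite /= !inE !negb_or !neqN ?eqr_opp //= andbT.
  have d (a b : F) : a ^+ 2 != b ^+ 2 -> (a != b) && (a != - b).
    by rewrite eqf_sqr negb_or.
  have /andP[-> ->] := d _ _ sq.
  by rewrite [- _ == q ^+ 2]eqr_oppLR; have /andP[_ ->] := d _ _ sq.
move=> cu1 cu2 /allpairsP[[c1 u1] [c1in u1in ->]].
move=> /allpairsP[[c2 u2] [/= c2in u2in ->]] h; rewrite /= in c1in u1in h *.
have u10 := generic_neq0 gus u1in; have u20 := generic_neq0 gus u2in.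
have {}h : c1 * u2 = c2 * u1.
  by rewrite -(divfK u10 c1) h; field; rewrite ?u20 ?u10.
have sqr_inj u v : u \in us -> v \in us -> u ^+ 2 = v ^+ 2 -> u = v.
  move=> u_us v_us uv; rewrite -(nth_index 0 u_us) -(nth_index 0 v_us).
  congr nth; apply/eqP; rewrite -(nth_uniq (0 ^+ 2) _ _ (generic_sqr gus)).
  - by rewrite !(nth_map 0) ?index_mem // !nth_index ?uv.
  - by rewrite size_map index_mem.
  - by rewrite size_map index_mem.
have sqE c : c \in [:: q ^- 2; - q ^- 2; q ^+ 2; - q ^+ 2] ->
    c != 0 /\ (c ^+ 2 = (q ^- 2) ^+ 2 \/ c ^+ 2 = (q ^+ 2) ^+ 2).
  by rewrite !inE => /or4P[]/eqP->; rewrite ?oppr_eq0 ?sqrrN; auto.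
have [c10 c1E] := sqE _ c1in; have [c20 c2E] := sqE _ c2in.
have h2 : c1 ^+ 2 * u2 ^+ 2 = c2 ^+ 2 * u1 ^+ 2 by rewrite -!exprMn h.
have u12 : c1 ^+ 2 = c2 ^+ 2 -> u1 = u2.
  move=> cc; rewrite cc in h2; have /esym uu := mulfI (expf_neq0 2 c20) h2.
  exact: sqr_inj uu.
have eq_c : u1 = u2 -> (c1, u1) = (c2, u2).
  by move=> uu; move: h; rewrite uu => /(mulIf u20) ->.
(* If the squares of [c1] and [c2] agree, so do those of [u1] and [u2]; otherwise the squares of
   [u1] and [u2] differ by a factor [q ^+ 8], which [generic_div] excludes. *)
case: c1E c2E => e1 [] e2; try by apply: eq_c; apply: u12; rewrite e1 e2.
  have := generic_div gus u2in u1in; case/eqP.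
  transitivity ((q ^+ 2) ^+ 2 * ((q ^- 2) ^+ 2 * u2 ^+ 2)); first by field.
  by rewrite -e1 h2 e2; ring.
have := generic_div gus u1in u2in; case/eqP.
transitivity ((q ^+ 2) ^+ 2 * ((q ^- 2) ^+ 2 * u1 ^+ 2)); first by field.
by rewrite -e2 -h2 e1; ring.
Qed.

(** Here the two recursions are seen to agree: the crossings of a line [y] with the U-turn produce
    the factor that [y] contributes on the right-hand side. The square of [sigma (q ^+ 4)] clears
    the denominators of the two crossings. *)
Lemma cap_right_gfac u y : u != 0 -> y != 0 -> sigma (u * y^-1) != 0 ->
  rmat_up y (q ^- 2 * u^-1) * rmat_up y u * sigma (q ^+ 4) ^+ 2
    * sigma (q ^- 2 * u^-1 * y^-1) =
  gfac u y / sigma (u * y^-1) * gfac (q ^- 2 * u^-1) y.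
Proof.
move=> u0 y0 uy; rewrite /rmat_up /gfac.
have -> : q ^+ 4 * (q ^- 2 * u^-1) / y = q ^+ 2 * u^-1 * y^-1 by field; rewrite ?q0 ?u0 ?y0 ?oner_eq0.
have -> : q ^- 2 * u^-1 * y^-1 = (q ^+ 2 * u * y)^-1 by rewrite !invfM.
have -> : q ^+ 2 * (q ^- 2 * u^-1) * y = (u * y^-1)^-1 by field; rewrite ?q0 ?u0 ?y0 ?oner_eq0.
have -> : q ^+ 2 * (q ^- 2 * u^-1)^-1 * y^-1 = q ^+ 4 * u / y by field; rewrite ?q0 ?u0 ?y0 ?oner_eq0.
by rewrite !sigmaV; field; rewrite ?uy ?s40 ?oner_eq0.
Qed.

Lemma cap_left_gfac u y : u != 0 -> y != 0 -> sigma (u * y^-1) != 0 ->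
  rmat_up (q ^+ 2 * u^-1) y * rmat_up u y * sigma (q ^+ 4) ^+ 2
    * sigma (q ^+ 2 * u^-1 * y^-1) =
  gfac u y / sigma (u * y^-1) * gfac (q ^+ 2 * u^-1) y.
Proof.
move=> u0 y0 uy; rewrite /rmat_up /gfac.
have -> : q ^+ 4 * y / (q ^+ 2 * u^-1) = q ^+ 2 * u * y by field; rewrite ?q0 ?u0 ?y0 ?oner_eq0.
have -> : q ^+ 2 * (q ^+ 2 * u^-1) * y = q ^+ 4 * y / u by field; rewrite ?q0 ?u0 ?y0 ?oner_eq0.
have -> : q ^+ 2 * (q ^+ 2 * u^-1)^-1 * y^-1 = u * y^-1 by field; rewrite ?q0 ?u0 ?y0 ?oner_eq0.
by field; rewrite ?uy ?s40 ?oner_eq0.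
Qed.

Lemma gfac_right u : u != 0 -> gfac (q ^- 2 * u^-1) u = 0.
Proof.
move=> u0; rewrite /gfac.
have -> : q ^+ 2 * (q ^- 2 * u^-1) * u = 1 by field; rewrite ?q0 ?u0 ?y0 ?oner_eq0.
by rewrite sigma1 mul0r.
Qed.

Lemma gfac_left u : u != 0 -> gfac (q ^+ 2 * u^-1) u = 0.
Proof.
move=> u0; rewrite /gfac.
have -> : q ^+ 2 * (q ^+ 2 * u^-1)^-1 * u^-1 = 1 by field; rewrite ?q0 ?u0 ?y0 ?oner_eq0.
by rewrite sigma1 mulr0.
Qed.

(* Both sides, times the product of the sigma (x / v), are Laurent polynomials of
   degree 2n in x and even or odd. They agree at the 4n special points, by the
   recursion Zus, and both vanish at x = u_1, where the Pfaffian has two equal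
   rows. *)
Lemma rhs_interpolation us x c c' w k :
    generic (rcons us x) -> (0 < size us)%N -> odd (size us + size e) ->
    (forall pre u post, us = pre ++ u :: post ->
       Zvec (pre ++ post) u = c' * rhs (pre ++ post) * w) ->
    (forall u, u != 0 ->
       kappa (q ^- 2 * u^-1) u = k /\ kappa (q ^+ 2 * u^-1) u = k) ->
    c' = c * k * sigma (q ^+ 4) ^+ 2 ^+ (size us).-1 ->
  Zvec us x = c * rhs (rcons us x) * w.
Proof.
move=> gusx us_gt0 odd_s Zus kE c'E.
have gus : generic us by apply: generic_subseq gusx; apply: subseq_rcons.
have x_in : x \in rcons us x by rewrite mem_rcons inE eqxx.
have us_in y : y \in us -> y \in rcons us x by rewrite mem_rcons inE orbC => ->.
have x0 := generic_neq0 gusx x_in.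
pose D y := Zvec us y * \prod_(v <- us) sigma (y * v^-1)
            - c * pref us * w * numer us y.
have lD : laurent (size us).*2 D.
  apply: laurentD.
    have -> : ((size us).*2 = size us + 1 * size us)%N by lia.
    apply: laurentM (laurent_Zvec us) _; apply: laurent_prod => v.
    by apply: eq_laurent (laurent_sigma v^-1) => y _; rewrite mulrC.
  apply: eq_laurent (laurentZ (- (c * pref us * w)) (laurent_numer us_gt0)) => y _.
  by rewrite mulNr.
have DN y : D (- y) = (-1) ^+ size us * D y.
  rewrite /D ZvecN numerN // mulrBr [in RHS](mulrCA _ (Zvec _ _)); congr (_ * _ - _); last first.
    by rewrite mulrCA.
  elim: (us) => [|v us' IH]; first by rewrite !big_nil mulr1.
  by rewrite !big_cons IH mulNr sigmaN exprS; ring.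
have DN0 y : D y = 0 -> D (- y) = 0 by rewrite DN => ->; rewrite mulr0.
have Dsp u : u \in us -> D (q ^- 2 * u^-1) = 0 /\ D (q ^+ 2 * u^-1) = 0.
  move=> u_us; have u0 := generic_neq0 gus u_us.
  have [pre [post usE]] : exists pre post, us = pre ++ u :: post.
    by case/splitPr: u_us => pre post; exists pre, post.
  have us_perm : perm_eq us (u :: pre ++ post) by rewrite usE perm_sym -cat1s perm_catCA.
  have mem_us y : y \in pre ++ post -> y \in us.
    by move=> ypp; rewrite (perm_mem us_perm) inE ypp orbT.
  have pp0 : all (fun y => y != 0) (pre ++ post).
    by apply/allP => y /mem_us/(generic_neq0 gus).
  have sz_pp : size (pre ++ post) = (size us).-1 by rewrite (perm_size us_perm).
  have suy y : y \in pre ++ post -> sigma (u * y^-1) != 0.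
    move=> ypp; apply: (generic_sigma gus u_us (mem_us _ ypp)).
    have := generic_sqr gus; rewrite (perm_uniq (perm_map _ us_perm)) /=.
    by case/andP => + _; apply: contra => /eqP ->; rewrite (map_f (fun x => x ^+ 2)).
  have [kR kL] := kE u u0; have Zpp := Zus _ _ _ usE.
  have q2 : q ^- 2 != 0 by rewrite invr_eq0 expf_neq0.
  rewrite /D usE; split; apply/eqP; rewrite subr_eq0; apply/eqP.
    have xR : q ^- 2 * u^-1 = (q ^+ 2 * u)^-1 by rewrite [RHS]invfM.
    apply: special_root _ _ (Zvec_cap_right pp0 u0 xR) _ (gfac_right u0) Zpp _.
    - by rewrite -usE.
    - by apply: mulf_neq0 => //; rewrite invr_eq0.
    - move=> y ypp; apply: cap_right_gfac => //; last exact: suy.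
      exact: (allP pp0).
    - by rewrite kR sz_pp.
  have q2' : q ^+ 2 != 0 by rewrite expf_neq0.
  apply: special_root _ _ (Zvec_cap_left pp0 u0 erefl) _ (gfac_left u0) Zpp _.
  - by rewrite -usE.
  - by apply: mulf_neq0 => //; rewrite invr_eq0.
  - move=> y ypp; apply: cap_left_gfac => //; last exact: suy.
    exact: (allP pp0).
  - by rewrite kL sz_pp.
have [u0 [us' usE]] : exists u us', us = u :: us'.
  by case: (us) us_gt0 => // u us' _; exists u, us'.
have u0_us : u0 \in us by rewrite usE mem_head.
have u00 := generic_neq0 gus u0_us.
have Du0 : D u0 = 0.
  have prod0 : \prod_(v <- us) sigma (u0 * v^-1) = 0.
    by rewrite (big_rem u0) //= mulfV // sigma1 mul0r.
  have pf0 : pf_list (u0 :: us) = 0.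
    have pfN := @pfl_swap F _ None entry charF entryN [::] (Some u0) (Some u0)
      (map Some us' ++ e).
    apply/eqP/negPn/negP => /neqN; rewrite /pf_list usE -pfN ?eqxx //.
    by move: odd_s; rewrite usE size_cat size_map.
  rewrite /D prod0 numerE // ?pf0 ?(mulr0, subrr) //.
  by apply/allP => v v_us; apply: generic_gfac gus _ _.
have Dx : D x = 0.
  apply: (laurent_eq0 lD (uniq_special_points gus u0_us)) => //.
    by rewrite /= size_allpairs ltnS -!mul2n mulnA.
  move=> r; rewrite inE => /orP[/eqP-> //|/special_pointP[u u_us [c0 [-> c0E _]]]].
  have u0' := generic_neq0 gus u_us; have [D1 D2] := Dsp u u_us.
  have c00 : c0 != 0 /\ D (c0 * u^-1) = 0.
    by case: c0E => [|[|[]]] ->; rewrite ?oppr_eq0 ?invr_eq0 ?expf_neq0 ?mulNr //;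
      split=> //; apply: DN0.
  by case: c00 => c00 ->; rewrite mulf_neq0 ?invr_eq0.
have gx v : v \in us -> gfac x v != 0.
  by move=> /us_in v_us; apply: generic_gfac gusx _ _.
have sx : \prod_(v <- us) sigma (x * v^-1) != 0.
  rewrite prodf_seq_neq0; apply/allP => v v_us /=.
  apply: (generic_sigma gusx x_in (us_in _ v_us)).
  have := generic_sqr gusx; rewrite map_rcons rcons_uniq => /andP[+ _].
  by apply: contra => /eqP ->; rewrite (map_f (fun x => x ^+ 2)).
apply: (mulIf sx); move/eqP: Dx; rewrite /D subr_eq0 => /eqP ->.
rewrite -rhs_rcons // numerE //; last by apply/allP.
rewrite /rhs /= prodf_div; field.
by rewrite sx.
Qed.
End Interpolation.

(** * The two factors and the induction on the number of lines *)

Hypothesis charF : [pchar F] =i pred0.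

Definition kappaP (x y : F) : F := 1.
(** The numerator of the two fractions in Q, up to [sigma (x / y)], over the common denominator
    [gfac x y]. *)
Definition kappaQ (x y : F) : F :=
  sigma (q ^+ 2 * x * y) + sigma (q ^+ 2 * x^-1 * y^-1).

Definition Plist (us : seq F) : F :=
  sigma (q ^+ 4) ^- ((size us)./2.-1 * size us) * rhs kappaP [::] us.
Definition Qlist (us : seq F) : F :=
  sigma (q ^+ 4) ^- ((size us)./2 * size us) * rhs kappaQ [:: None] us.

Lemma kappaQC x y : kappaQ x y = kappaQ y x.
Proof. by rewrite /kappaQ mulrAC; congr (_ + sigma _); rewrite mulrAC. Qed.

Lemma laurent_kappaQ y : laurent 1 (kappaQ^~ y).
Proof.
apply: laurentD.
  by apply: eq_laurent (laurent_sigma (q ^+ 2 * y)) => x _; rewrite mulrAC.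
by apply: eq_laurent (laurent_sigmaV (q ^+ 2 / y)) => x _; rewrite mulrAC.
Qed.

Lemma kappaQN x y : kappaQ (- x) y = - kappaQ x y.
Proof. by rewrite /kappaQ invrN !(mulrN, mulNr) !sigmaN -opprD. Qed.

Lemma kappaQ_special u : u != 0 ->
  kappaQ (q ^- 2 * u^-1) u = sigma (q ^+ 4) /\ kappaQ (q ^+ 2 * u^-1) u = sigma (q ^+ 4).
Proof.
move=> u0; rewrite /kappaQ; split.
  have -> : q ^+ 2 * (q ^- 2 * u^-1) * u = 1 by field; rewrite ?q0 ?u0 ?oner_eq0.
  have -> : q ^+ 2 * (q ^- 2 * u^-1)^-1 * u^-1 = q ^+ 4
    by field; rewrite ?q0 ?u0 ?oner_eq0.
  by rewrite sigma1 add0r.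
have -> : q ^+ 2 * (q ^+ 2 * u^-1) * u = q ^+ 4 by field; rewrite ?q0 ?u0 ?oner_eq0.
have -> : q ^+ 2 * (q ^+ 2 * u^-1)^-1 * u^-1 = 1 by field; rewrite ?q0 ?u0 ?oner_eq0.
by rewrite sigma1 addr0.
Qed.

Lemma pf0 (A : nat -> nat -> F) : pf 0 A = 1.
Proof.
rewrite /pf (big_pred1 1%g) => [|s /=].
  by rewrite /pf_term odd_perm1 big_ord0 mulr1.
have -> : s = 1%g by apply/permP => -[].
by rewrite eqxx; apply/andP; split; apply/forallP => -[].
Qed.

Lemma Zvec_list us x : generic (rcons us x) ->
  Zvec us x = if odd (size us) then Plist (rcons us x) * Qlist us
              else Plist us * Qlist (rcons us x).
Proof.
have [n] := ubnP (size us); elim: n us x => // n IH us x lt_n gusx.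
have [->|us_gt0] := eqVneq us [::].
  rewrite /Plist /Qlist /rhs /pf_list /= big_nil pfl_cons //= big_ord1 /pfl /= !pf0.
  by rewrite /Zvec /vec /= expr0 invr1 !mul1r.
have gus : generic us by apply: generic_subseq gusx; apply: subseq_rcons.
(* The reduced parameters together with [u] are a rearrangement of [us]. The factor that contains
   all of them is symmetric, hence the same for every choice of [u]. *)
have IHus pre u post : us = pre ++ u :: post ->
   Zvec (pre ++ post) u = if odd (size us) then Plist (pre ++ post) * Qlist us
              else Plist us * Qlist (pre ++ post).
  move=> usE; have us_perm : perm_eq us (rcons (pre ++ post) u).
    by rewrite perm_sym perm_rcons usE -cat1s perm_catCA.
  have sz_us := perm_size us_perm; rewrite size_rcons in sz_us.
  rewrite IH; last exact: generic_perm us_perm gus.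
    rewrite sz_us /=; case: ifP => odd_pp /=.
      rewrite [in RHS]/Plist [in X in rhs _ _ X]usE rhs_move -?usE //.
      - by rewrite [in LHS]/Plist size_rcons sz_us.
      - by rewrite addn0 sz_us /= odd_pp.
    rewrite [in RHS]/Qlist [in X in rhs _ _ X]usE rhs_move -?usE //.
    - by rewrite [in X in _ * X = _]/Qlist size_rcons sz_us.
    - exact: kappaQC.
    - by rewrite addn1 sz_us /= odd_pp.
  by rewrite -ltnS -sz_us.
have sz_gt0 : (0 < size us)%N by rewrite lt0n size_eq0.
have sz_del pre u post : us = pre ++ u :: post -> size (pre ++ post) = (size us).-1.
  by move=> ->; rewrite !size_cat addnS.
have s4X a b : (a <= b)%N -> sigma (q ^+ 4) ^- a = sigma (q ^+ 4) ^- b * sigma (q ^+ 4) ^+ (b - a).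
  move=> le_ab; have -> : sigma (q ^+ 4) ^+ b = sigma (q ^+ 4) ^+ a * sigma (q ^+ 4) ^+ (b - a).
    by rewrite -exprD subnKC.
  by rewrite invfM divfK // expf_neq0.
case: ifP => odd_us.
  pose c' := sigma (q ^+ 4) ^- ((size us).-1./2.-1 * (size us).-1).
  rewrite /Plist; apply: (@rhs_interpolation charF _ _ _ _ _ _ us x _ c' _ 1) => //.
  - by left.
  - by move=> y; apply: laurent_le (laurentC 1).
  - by move=> y z; rewrite expr0 mul1r.
  - by rewrite addn0.
  - by move=> pre u post usE; rewrite (IHus _ _ _ usE) odd_us /Plist (sz_del _ _ _ usE).
  rewrite mulr1 -exprM size_rcons /c'.
  have [p pE] : exists p, size us = p.*2.+1 by exists (size us)./2; lia.
  rewrite pE /= ?(doubleK, uphalf_double).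
  (* From 2p to 2p + 2 parameters the exponent in P grows by 4p: two for each of the 2p lines that
     cross the U-turn. *)
  have le : (p.-1 * p.*2 <= p * p.*2.+2)%N by apply: leq_mul; lia.
  rewrite (s4X _ _ le); congr (_ * _ ^+ _).
  by case: p {pE le} => //= p; nia.
pose c' := sigma (q ^+ 4) ^- ((size us).-1./2 * (size us).-1).
rewrite /Qlist [RHS]mulrC.
apply: (@rhs_interpolation charF _ _ _ _ _ _ us x _ c' _ (sigma (q ^+ 4))) => //.
- exact: kappaQC.
- by right.
- exact: laurent_kappaQ.
- by move=> y z; rewrite kappaQN expr1 mulN1r.
- by rewrite addn1 /= odd_us.
- move=> pre u post usE; rewrite (IHus _ _ _ usE) odd_us /Qlist (sz_del _ _ _ usE).
  by rewrite [LHS]mulrC.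
- exact: kappaQ_special.
rewrite -exprM -mulrA -exprS size_rcons /c'.
have [p pE] : exists p, size us = p.*2.+2 by exists (size us)./2.-1; lia.
rewrite pE /= ?(doubleK, uphalf_double).
(* From 2p + 1 to 2p + 3 parameters the exponent in Q grows by 4p + 3: two for each of the 2p + 1
   crossed lines, and one for the value of [kappaQ] at the special points. *)
have le : (p * p.*2.+1 <= p.+1 * p.*2.+3)%N by apply: leq_mul; lia.
rewrite (s4X _ _ le); congr (_ * _ ^+ _).
by nia.
Qed.

(** * Configurations as functions on the edges *)

(* (true, i, j) is the vertical edge above (i, j), and (false, i, j) is the
   horizontal edge to the right of (i, j); the value true means up or right. *)
Definition edge := (bool * nat * nat)%type.
Implicit Types (f g : edge -> bool) (es : seq edge).

Definition upd f (e : edge) (b : bool) : edge -> bool :=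
  fun x => if x == e then b else f x.

(* The sum of G over all functions that agree with f outside es. *)
Fixpoint asum es (G : (edge -> bool) -> F) f : F :=
  if es is e :: es' then \sum_(b : bool) asum es' G (upd f e b) else G f.

Lemma asum_cons e es G f :
  asum (e :: es) G f = \sum_(b : bool) asum es G (upd f e b).
Proof. by []. Qed.

Lemma asum_cat es es' G f : asum (es ++ es') G f = asum es (asum es' G) f.
Proof. by elim: es f => //= e es IH f; apply: eq_bigr => b _; apply: IH. Qed.

Lemma eq_asum es G G' f :
    (forall g, (forall x, x \notin es -> g x = f x) -> G g = G' g) ->
  asum es G f = asum es G' f.
Proof.
elim: es f => [|e es IH] f eqG /=; first exact: eqG.
apply: eq_bigr => b _; apply: IH => g gf; apply: eqG => x.
by rewrite inE negb_or => /andP[xe xes]; rewrite gf // /upd (negbTE xe).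
Qed.

Lemma asumZ es c G f : asum es (fun g => c * G g) f = c * asum es G f.
Proof.
elim: es f => //= e es IH f; rewrite mulr_sumr.
by apply: eq_bigr => b _; apply: IH.
Qed.

Variables (n : nat) (u : nat -> F).

Definition colpar (j : nat) : F := u (minn j (n.*2.+2 - j)).

(** The order is that of the sums in [row]: at each vertex first the lower edge, then the right
    one. *)
Definition row_edges i js : seq edge :=
  flatten [seq [:: (true, i.+1, j); (false, i, j)] | j <- js].

Definition bulk_at f i j : F :=
  bulk (u i * colpar j) (f (true, i, j)) (f (true, i.+1, j))
    (f (false, i, j.-1)) (f (false, i, j)).

Lemma mem_row_edges i js b k j :
  ((b, k, j) \in row_edges i js) = (k == if b then i.+1 else i) && (j \in js).
Proof.
elim: js => [|j' js IH]; first by rewrite andbF.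
rewrite /row_edges /= !inE -/(row_edges i js) {}IH !xpair_eqE.
by case: b; rewrite /= ?orbF ?andb_orr.
Qed.

Lemma asum_row i j k psi f :
  asum (row_edges i (iota j.+1 k)) (fun g =>
     \prod_(m <- iota j.+1 k) bulk_at g i m *
     (if g (true, i, (j + k).+1) == g (false, i, (j + k)%N) then 0 else
      psi [seq g (true, i.+1, m) | m <- iota j.+1 k])) f =
  row (u i) [seq colpar m | m <- iota j.+1 k] (f (false, i, j))
    [seq f (true, i, m) | m <- iota j.+1 k.+1] psi.
Proof.
elim: k j psi f => [|k IH] j psi f /=.
  by rewrite big_nil mul1r addn0 eq_sym.
apply: eq_bigr => s _; apply: eq_bigr => e _.
set f' := upd _ _ _.
have f'V m : f' (true, i, m) = f (true, i, m).
  by rewrite /f' /upd !xpair_eqE /=; case: eqP => // /n_Sn.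
have f'S : f' (true, i.+1, j.+1) = s by rewrite /f' /upd !xpair_eqE /= !eqxx.
have f'E : f' (false, i, j.+1) = e by rewrite /f' /upd !xpair_eqE /= !eqxx.
have f'W : f' (false, i, j) = f (false, i, j).
  by rewrite /f' /upd !xpair_eqE /= eqxx; case: eqP => // /n_Sn.
rewrite -/(row_edges i (iota j.+2 k)).
have f'H : [seq f (true, i, m) | m <- iota j.+2 k.+1] = [seq f' (true, i, m) | m <- iota j.+2 k.+1].
  by apply: eq_map => m; rewrite f'V.
rewrite -[f (true, i, j.+2) :: _]/[seq f (true, i, m) | m <- iota j.+2 k.+1] f'H.
rewrite -[e in RHS]f'E -(IH j.+1 (fun l => psi (s :: l)) f') -asumZ.
apply: eq_asum => g gf.
have gf' b k' m : (k' != if b then i.+1 else i) || (m \notin iota j.+2 k) ->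
    g (b, k', m) = f' (b, k', m).
  by move=> h; apply: gf; rewrite mem_row_edges negb_and.
have gV m : g (true, i, m) = f' (true, i, m).
  by apply: gf'; rewrite /= neq_ltn ltnSn.
have out m : (m < j.+2)%N -> m \notin iota j.+2 k by rewrite mem_iota; lia.
rewrite big_cons /bulk_at gV f'V gf' ?out ?orbT // f'S gf' ?out ?orbT //= f'W.
rewrite gf' ?out ?orbT // f'E mulrA; congr (_ * _ * _).
by rewrite addnS addSn.
Qed.

Lemma map_colpar i d : (i + d = n)%N ->
  [seq colpar m | m <- iota i.+1 d.*2.+1] = cols (map u (iota i.+1 d)) (u n.+1).
Proof.
move=> idn; rewrite colsE; have -> : d.*2.+1 = (d + d.+1)%N by rewrite addnS addnn.
rewrite iotaD map_cat addSn idn /=; congr (_ ++ _ :: _).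
- by apply/eq_in_map => m; rewrite mem_iota /colpar => h; congr u; lia.
- by rewrite /colpar; congr u; lia.
apply: (@eq_from_nth _ 0) => [|p]; rewrite ?size_rev !size_map !size_iota // => lt_p.
rewrite nth_rev size_map size_iota // !(nth_map 0%N) ?size_iota //; last lia.
by rewrite !nth_iota /colpar; [congr u | |]; lia.
Qed.

(** Boundary weights are set to 1 here; they reappear as [left_factor] and [right_factor]. *)
Definition row_at f i : F :=
  if f (true, i, i) == f (false, i, i) then
    \prod_(m <- iota i.+1 (n - i).*2.+1) bulk_at f i m *
    (if f (true, i, n.*2.+2 - i)%N == f (false, i, n.*2.+1 - i)%N then 0 else 1)
  else 0.

Definition tri_edges i d : seq edge :=
  flatten [seq (false, k, k) :: row_edges k (iota k.+1 (n - k).*2.+1) | k <- iota i d].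

Lemma mem_tri_edges i d b k m : (b, k, m) \in tri_edges i d -> (i <= k)%N /\ (b -> i < k)%N.
Proof.
case/flattenP => s /mapP[l]; rewrite mem_iota => /andP[il _] ->.
rewrite inE mem_row_edges !xpair_eqE => /orP[/andP[/andP[/eqP-> /eqP->] _]|] //.
by case/andP => + _; case: b => /eqP -> //; split=> //; rewrite ltnW.
Qed.

Lemma asum_tri i d f : (i + d = n.+1)%N ->
  asum (tri_edges i d) (fun g => \prod_(k <- iota i d) row_at g k) f =
  vec (map u (iota i d)) (u n.+1) [seq f (true, i, m) | m <- iota i d.*2.+1].
Proof.
elim: d i f => [|d IH] i f idn; first by rewrite /= big_nil.
have dE : (n - i = d)%N by lia.
have -> : tri_edges i d.+1 =
    (false, i, i) :: (row_edges i (iota i.+1 d.*2.+1) ++ tri_edges i.+1 d).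
  by rewrite -dE.
rewrite asum_cons; under eq_bigr => b _ do rewrite asum_cat.
set X := asum (tri_edges i.+1 d) _.
pose psi := vec (map u (iota i.+1 d)) (u n.+1).
have XE g : X g = row_at g i * psi [seq g (true, i.+1, m) | m <- iota i.+1 d.*2.+1].
  rewrite /X /psi -(IH i.+1 g) ?addSnnS // -asumZ; apply: eq_asum => h hg.
  rewrite big_cons; congr (_ * _).
  have hgE (b : bool) k m : (k <= i + b)%N -> h (b, k, m) = g (b, k, m).
    move=> le_k; apply: hg; apply/negP => /mem_tri_edges[]; case: b le_k => /=; lia.
  rewrite /row_at !hgE ?addn0 ?addn1 //; case: ifP => // _; congr (_ * _).
  by apply: eq_bigr => m _; rewrite /bulk_at !hgE ?addn0 ?addn1.
have asumX g : asum (row_edges i (iota i.+1 d.*2.+1)) X g =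
    if g (true, i, i) == g (false, i, i) then
      row (u i) [seq colpar m | m <- iota i.+1 d.*2.+1] (g (false, i, i))
        [seq g (true, i, m) | m <- iota i.+1 d.*2.+2] psi
    else 0.
  rewrite -asum_row -[if _ then _ else _]mul1r.
  transitivity ((if g (true, i, i) == g (false, i, i) then 1 else 0) *
    asum (row_edges i (iota i.+1 d.*2.+1)) (fun g =>
     \prod_(m <- iota i.+1 d.*2.+1) bulk_at g i m *
     (if g (true, i, (i + d.*2.+1).+1) == g (false, i, (i + d.*2.+1)%N) then 0 else
      psi [seq g (true, i.+1, m) | m <- iota i.+1 d.*2.+1])) g); last first.
    by case: eqP; rewrite ?mul1r ?mul0r.
  rewrite -asumZ; apply: eq_asum => h hg; rewrite XE /row_at.
  have hgE b : h (b, i, i) = g (b, i, i).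
    by apply: hg; rewrite mem_row_edges mem_iota ltnn andbF.
  rewrite !hgE dE.
  have -> : (n.*2.+2 - i = (i + d.*2.+1).+1)%N by lia.
  have -> : (n.*2.+1 - i = i + d.*2.+1)%N by lia.
  by case: eqP => _; rewrite ?mul0r // mul1r -mulrA; case: eqP; rewrite ?mul0r ?mul1r.
rewrite !big_bool !asumX map_colpar; last by lia.
have updV b m : upd f (false, i, i) b (true, i, m) = f (true, i, m).
  by rewrite /upd !xpair_eqE.
have updH b : upd f (false, i, i) b (false, i, i) = b by rewrite /upd eqxx.
have updM b s : [seq upd f (false, i, i) b (true, i, m) | m <- s] = [seq f (true, i, m) | m <- s].
  by apply: eq_map => m; rewrite updV.
rewrite !updH !updV !updM.
rewrite -[vec _ _]/(layer (u i) (cols (map u (iota i.+1 d)) (u n.+1)) psi) doubleS.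
rewrite -[[seq _ | _ <- iota i _]]/(f (true, i, i) :: [seq f (true, i, m) | m <- iota i.+1 d.*2.+2]).
rewrite /layer.
by case: (f (true, i, i)); rewrite /= ?addr0 ?add0r.
Qed.

Lemma Zvec_asum :
  Zvec (map u (iota 1 n)) (u n.+1) =
  asum (tri_edges 1 n) (fun g => \prod_(k <- iota 1 n) row_at g k) (fun=> true).
Proof.
rewrite asum_tri ?add1n // /Zvec size_map size_iota; congr vec.
by apply: (@eq_from_nth _ true) => [|p]; rewrite size_nseq ?size_map ?size_iota // => lt_p;
  rewrite nth_nseq lt_p (nth_map 0%N) ?size_iota.
Qed.

(** The bit [b] is added as a number: vertical edges reach down to row n + 1 and right to column 2n
    + 2 - i, horizontal ones start at most in row n and one column earlier. *)
Definition is_edge (e : edge) : bool :=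
  let: (b, i, j) := e in
  ((1 <= i <= n + b) && (i <= j) && (j + i <= n.*2.+1 + b))%N.

Lemma mem_tri_edges1 b i j :
  ((b, i, j) \in tri_edges 1 n) = is_edge (b, i, j) && (b ==> (1 < i)%N).
Proof.
apply/flattenP/idP => [[s /mapP[k]]|].
  rewrite mem_iota => /andP[k1 kn] ->; rewrite inE mem_row_edges !xpair_eqE mem_iota.
  case: b => /=; first by case/andP => /eqP ->; lia.
  by case/orP => [/andP[/eqP-> /eqP->]|/andP[/eqP->]]; lia.
move=> h; exists ((false, i - b, i - b)%N :: row_edges (i - b) (iota (i - b).+1 (n - (i - b)).*2.+1)).
  by apply: (map_f (fun k => (false, k, k) :: row_edges k (iota k.+1 (n - k).*2.+1)));
    rewrite mem_iota; case: b h => /=; lia.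
rewrite inE mem_row_edges !xpair_eqE mem_iota; case: b h => /= h.
  by apply/andP; split; lia.
rewrite subn0 eqxx /=; case: eqP => //= ij; lia.
Qed.

Lemma uniq_row_edges i js : uniq js -> uniq (row_edges i js).
Proof.
elim: js => //= j js IH /andP[j_js /IH us]; rewrite /row_edges /= -/(row_edges i js) us.
by rewrite inE !mem_row_edges !xpair_eqE /= (negbTE j_js) !andbF.
Qed.

Lemma uniq_tri_edges i d : uniq (tri_edges i d).
Proof.
elim: d i => // d IH i.
have -> : tri_edges i d.+1 =
    (false, i, i) :: (row_edges i (iota i.+1 (n - i).*2.+1) ++ tri_edges i.+1 d) by [].
rewrite cons_uniq cat_uniq IH uniq_row_edges ?iota_uniq // !andbT andTb.
rewrite mem_cat negb_or mem_row_edges mem_iota ltnn andbF andTb; apply/andP; split.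
  by apply/negP => /mem_tri_edges[]; rewrite ltnn.
apply/hasPn => -[[b k] m] /mem_tri_edges[ik bk].
change ((b, k, m) \notin row_edges i (iota i.+1 (n - i).*2.+1)).
by rewrite mem_row_edges; case: b bk => /= bk; apply/nandP; left; apply/eqP; lia.
Qed.

(** * Orientations of the graph and functions on its edges *)

Implicit Types (x y : grid n) (D : {set grid n * grid n}).

Lemma pt1 i j : (i <= n.+1)%N -> (pt n i j).1 = i :> nat.
Proof. by move=> i_le; rewrite /= inordK. Qed.

Lemma pt2 i j : (j <= n.*2.+1)%N -> (pt n i j).2 = j :> nat.
Proof. by move=> j_le; rewrite /= inordK. Qed.

Lemma ptK x : pt n x.1 x.2 = x.
Proof. by rewrite /pt !inord_val -surjective_pairing. Qed.

Lemma pt_eq x i j : x.1 = i :> nat -> x.2 = j :> nat -> x = pt n i j.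
Proof. by move=> <- <-; rewrite ptK. Qed.

Lemma vedgeE x y : vedge x y =
  is_edge (true, nat_of_ord y.1, nat_of_ord y.2) && (x == pt n y.1.-1 y.2).
Proof.
have y1 := ltn_ord y.1; have y2 := ltn_ord y.2.
apply/and4P/andP => [[xv yv /eqP yx /eqP y2x]|[ey /eqP ->]].
  split; first by move: xv yv; rewrite /is_vertex /is_edge yx; lia.
  by apply/eqP/pt_eq; rewrite ?yx ?y2x.
rewrite /is_vertex pt1; last by lia.
rewrite pt2; last by lia.
by move: ey => /= ey; split; [lia | lia | lia | apply/eqP/val_inj; rewrite /= inordK].
Qed.

Lemma hedgeE x y : hedge x y =
  is_edge (false, nat_of_ord x.1, nat_of_ord x.2) && (y == pt n x.1 x.2.+1).
Proof.
have x1 := ltn_ord x.1; have x2 := ltn_ord x.2.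
apply/and5P/andP => [[xv yv x0 /eqP yx /eqP y2x]|[ex /eqP ->]].
  split; first by move: xv yv; rewrite /is_vertex /is_edge yx y2x; lia.
  by apply/eqP/pt_eq; rewrite ?yx ?y2x.
move: ex; rewrite /is_edge !addn0 => ex; rewrite /is_vertex pt1; last by lia.
rewrite pt2; last by lia.
by split; [lia | lia | lia | apply/eqP/val_inj; rewrite /= inordK | ].
Qed.

Definition arc f x y : bool :=
  [|| vedge y x && f (true, nat_of_ord x.1, nat_of_ord x.2),
      vedge x y && ~~ f (true, nat_of_ord y.1, nat_of_ord y.2),
      hedge x y && f (false, nat_of_ord x.1, nat_of_ord x.2)
    | hedge y x && ~~ f (false, nat_of_ord y.1, nat_of_ord y.2)].

Definition arcs f : {set grid n * grid n} := [set a | arc f a.1 a.2].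

Definition dir D (e : edge) : bool :=
  let: (b, i, j) := e in
  if b then (pt n i j, pt n i.-1 j) \in D else (pt n i j, pt n i j.+1) \in D.

Lemma orientationP D : reflect
  (forall x y, if adjacent x y then ((x, y) \in D) = ~~ ((y, x) \in D) else (x, y) \notin D)
  (is_orientation D).
Proof.
apply: (iffP forallP) => [h x y|h x].
  by have /forallP/(_ y) := h x; case: ifP => //; case: (_ \in D); case: (_ \in D).
by apply/forallP => y; have := h x y; case: ifP => // _ ->; case: (_ \in D).
Qed.

Lemma edge_exclusive x y :
  ((vedge x y + vedge y x + hedge x y + hedge y x)%N <= 1)%N.
Proof.
case: (boolP (vedge x y)) => [/and4P[_ _ /eqP a1 /eqP/(congr1 val)/= a2]|_];
case: (boolP (vedge y x)) => [/and4P[_ _ /eqP b1 /eqP/(congr1 val)/= b2]|_];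
case: (boolP (hedge x y)) => [/and5P[_ _ _ /eqP/(congr1 val)/= c1 /eqP c2]|_];
case: (boolP (hedge y x)) => [/and5P[_ _ _ /eqP/(congr1 val)/= d1 /eqP d2]|_] //=;
  try (exfalso; lia).
Qed.

Lemma adjacentE x y : adjacent x y = [|| vedge x y, vedge y x, hedge x y | hedge y x].
Proof. by []. Qed.

Lemma adjacentC x y : adjacent x y = adjacent y x.
Proof. by rewrite !adjacentE; do !case: (vedge _ _); do !case: (hedge _ _). Qed.

Lemma arcs_orientation f : is_orientation (arcs f).
Proof.
apply/orientationP => x y; rewrite !inE /= /arc adjacentE.
have := edge_exclusive x y.
by case: (vedge x y); case: (vedge y x); case: (hedge x y); case: (hedge y x);
  rewrite //= ?orbF ?negbK.
Qed.

Lemma eq_arc f g x y : (forall e, is_edge e -> f e = g e) -> arc f x y = arc g x y.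
Proof.
move=> fg; rewrite /arc; congr [|| _, _, _ | _].
- by case: (boolP (vedge y x)) => //; rewrite vedgeE => /andP[/fg-> _].
- by case: (boolP (vedge x y)) => //; rewrite vedgeE => /andP[/fg-> _].
- by case: (boolP (hedge x y)) => //; rewrite hedgeE => /andP[/fg-> _].
- by case: (boolP (hedge y x)) => //; rewrite hedgeE => /andP[/fg-> _].
Qed.

Lemma dir_up D x y : vedge y x -> dir D (true, nat_of_ord x.1, nat_of_ord x.2) = ((x, y) \in D).
Proof. by rewrite vedgeE => /andP[_ /eqP ->]; rewrite /dir ptK. Qed.

Lemma dir_right D x y : hedge x y -> dir D (false, nat_of_ord x.1, nat_of_ord x.2) = ((x, y) \in D).
Proof. by rewrite hedgeE => /andP[_ /eqP ->]; rewrite /dir ptK. Qed.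

Lemma arc_dir D x y : is_orientation D -> arc (dir D) x y = ((x, y) \in D).
Proof.
move/orientationP => oD; have := oD x y; have := edge_exclusive x y; rewrite adjacentE /arc.
have [xy|_] := boolP (vedge x y).
  rewrite (dir_up _ xy); case: (vedge y x); case: (hedge x y); case: (hedge y x) => //= _ ->.
  by rewrite orbF.
have [yx|_] := boolP (vedge y x).
  by rewrite (dir_up _ yx); case: (hedge x y); case: (hedge y x) => //= _ _; rewrite orbF.
have [xy|_] := boolP (hedge x y).
  by rewrite (dir_right _ xy); case: (hedge y x) => //= _ _; rewrite orbF.
have [yx|_] := boolP (hedge y x).
  by rewrite (dir_right _ yx) /= => _ ->.
by move=> _ /= /negbTE ->.
Qed.

Lemma vedge_pt i j : is_edge (true, i, j) -> vedge (pt n i.-1 j) (pt n i j).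
Proof. by move=> /= e; rewrite vedgeE pt1 ?pt2 /= ?eqxx ?andbT; lia. Qed.

Lemma hedge_pt i j : is_edge (false, i, j) -> hedge (pt n i j) (pt n i j.+1).
Proof. by move=> /= e; rewrite hedgeE pt1 ?pt2 /= ?eqxx ?andbT; lia. Qed.

Lemma dir_arcs f e : is_edge e -> dir (arcs f) e = f e.
Proof.
case: e => [[[] i] j] e; rewrite /dir inE /= /arc.
  have v := vedge_pt e; have := edge_exclusive (pt n i.-1 j) (pt n i j).
  have [lei lej] : (i <= n.+1)%N /\ (j <= n.*2.+1)%N by move: e => /=; lia.
  rewrite v !(pt1 _ lei) !(pt2 _ lej).
  by case: (vedge _ _); case: (hedge _ _); case: (hedge _ _) => //=; rewrite orbF.
have h := hedge_pt e; have := edge_exclusive (pt n i j) (pt n i j.+1).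
have [lei lej] : (i <= n.+1)%N /\ (j <= n.*2.+1)%N by move: e => /=; lia.
rewrite h !(pt1 _ lei) !(pt2 _ lej).
by case: (vedge _ _); case: (vedge _ _); case: (hedge _ _) => //=; rewrite orbF.
Qed.

Definition edges : seq edge := [seq (true, 1%N, j) | j <- iota 1 n.*2.+1] ++ tri_edges 1 n.

Lemma mem_edges e : (e \in edges) = is_edge e.
Proof.
case: e => [[b i] j]; rewrite mem_cat mem_tri_edges1.
have -> : ((b, i, j) \in [seq (true, 1%N, j) | j <- iota 1 n.*2.+1]) =
          [&& b, i == 1%N & (1 <= j < n.*2.+2)%N].
  by apply/mapP/and3P => [[m]|[-> /eqP-> jm]];
    [rewrite mem_iota => h [-> -> ->] | exists j; rewrite ?mem_iota].
case: b => /=; rewrite ?andbT //; apply/idP/idP; last lia.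
by case/orP; lia.
Qed.

Definition agree es f D : bool :=
  is_orientation D && all (fun e => (e \in es) || (dir D e == f e)) edges.

(** On orientations, [arcs] and [dir] are inverse to each other. The condition on [G] is there
    because a function on [edge] also has values outside the graph. *)
Lemma asum_dir es G f : uniq es -> {subset es <= is_edge} ->
    (forall g h, (forall e, is_edge e -> g e = h e) -> G g = G h) ->
  asum es G f = \sum_(D | agree es f D) G (dir D).
Proof.
move=> + + extG; elim: es f => [|e es IH] f /=.
  move=> _ _; rewrite (big_pred1 (arcs f)) => [|D].
    by apply: extG => e /dir_arcs->.
  rewrite /agree; apply/andP/eqP => [[oD /allP Df]|->].
    apply/setP => -[x y]; rewrite inE /= -(arc_dir _ _ oD); apply: eq_arc => e.
    by rewrite -mem_edges => /Df/eqP.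
  rewrite arcs_orientation; split=> //; apply/allP => e.
  by rewrite mem_edges => /dir_arcs->; rewrite eqxx orbT.
move=> /andP[e_es us] sub; have ee : is_edge e by apply: (sub e); rewrite mem_head.
rewrite (partition_big (fun D => dir D e) xpredT) //; apply: eq_bigr => b _.
rewrite IH //; last by move=> x xes; apply: sub; rewrite inE xes orbT.
apply: eq_bigl => D; rewrite /agree -andbA; congr (_ && _).
apply/allP/andP => [h|[/allP h /eqP De] x].
  split; last by have := h e; rewrite mem_edges /upd eqxx (negbTE e_es); apply.
  by apply/allP => x /h; rewrite inE /upd; case: (x =P e).
move=> /h; rewrite inE /upd; case: (x =P e) => [-> _|_ //].
by rewrite De eqxx orbT.
Qed.

(** * Vertex weights *)

Definition bulk_ok D x : bool :=
  (#|[set y | (y, x) \in D]| == 2) && (#|[set y | (x, y) \in D]| == 2).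

Lemma card_count (T : finType) (p : pred T) (s : seq T) :
  uniq s -> (forall z, p z -> z \in s) -> #|[set z | p z]| = count p s.
Proof.
move=> us sp; rewrite -size_filter -(card_uniqP (filter_uniq p us)).
apply: eq_card => z; rewrite inE mem_filter; case: (boolP (p z)) => // pz.
by rewrite sp.
Qed.

Section Vertex.
Variables (D : {set grid n * grid n}) (x : grid n).
Hypotheses (oD : is_orientation D).
Let i : nat := x.1.
Let j : nat := x.2.
Let f := dir D.

Let xE : pt n i j = x := ptK x.

Lemma out_up : (x, pt n i.-1 j) \in D = f (true, i, j).
Proof. by rewrite /f /dir xE. Qed.

Lemma out_right : (x, pt n i j.+1) \in D = f (false, i, j).
Proof. by rewrite /f /dir xE. Qed.

Lemma out_down : is_edge (true, i.+1, j) -> (x, pt n i.+1 j) \in D = ~~ f (true, i.+1, j).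
Proof.
move=> /vedge_pt; rewrite -[i.+1.-1]/i xE => v.
have -> : f (true, i.+1, j) = ((pt n i.+1 j, x) \in D) by rewrite -{1}xE.
by move/orientationP: oD => /(_ x (pt n i.+1 j)); rewrite adjacentE v => ->.
Qed.

Lemma out_left : (0 < j)%N -> is_edge (false, i, j.-1) ->
  (x, pt n i j.-1) \in D = ~~ f (false, i, j.-1).
Proof.
move=> j0 /hedge_pt; rewrite /f /dir prednK // xE => h.
by move/orientationP: oD => /(_ x (pt n i j.-1)); rewrite adjacentE h !orbT => ->.
Qed.

(** [bulk_weight] may be nonzero in states with the wrong number of incoming edges, whereas [bulk]
    vanishes there; [bulk_ok] makes up for the difference. *)
Lemma bulk_vertex : is_bulk x ->
  (if bulk_ok D x then vertex_weight q u D x else 0) = bulk_at f i j.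
Proof.
move=> bx; have {}bx' : (1 <= i <= n)%N /\ (i < j < n.*2.+2 - i)%N.
  by move: bx => /andP[].
have eN : is_edge (true, i, j) by rewrite /is_edge; lia.
have eS : is_edge (true, i.+1, j) by rewrite /is_edge; lia.
have eE : is_edge (false, i, j) by rewrite /is_edge; lia.
have eW : is_edge (false, i, j.-1) by rewrite /is_edge; lia.
have j0 : (0 < j)%N by lia.
pose s := [:: pt n i.-1 j; pt n i.+1 j; pt n i j.-1; pt n i j.+1].
have adj_s y : adjacent x y -> y \in s.
  rewrite adjacentE !inE => /or4P[|||].
  - case/and4P => _ _ /eqP y1 /eqP y2.
    have -> : y = pt n i.+1 j by apply: pt_eq; rewrite // y2.
    by rewrite !eqxx !orbT.
  - case/and4P => _ _ /eqP y1 /eqP y2.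
    have -> : y = pt n i.-1 j by apply: pt_eq; rewrite /i /j ?y1 ?y2.
    by rewrite !eqxx.
  - case/and5P => _ _ _ /eqP y1 /eqP y2.
    have -> : y = pt n i j.+1 by apply: pt_eq; rewrite // y1.
    by rewrite !eqxx !orbT.
  case/and5P => _ _ _ /eqP y1 /eqP y2.
  have -> : y = pt n i j.-1 by apply: pt_eq; rewrite /i /j ?y1 ?y2.
  by rewrite !eqxx !orbT.
have us : uniq s.
  have ptn a b c d : (a <= n.+1)%N -> (c <= n.+1)%N -> (b <= n.*2.+1)%N -> (d <= n.*2.+1)%N ->
      (pt n a b == pt n c d) = (a == c) && (b == d).
    move=> la lc lb ld; apply/eqP/andP => [e|[/eqP-> /eqP->] //].
    split; apply/eqP.
      by have := congr1 (fun p : grid n => nat_of_ord p.1) e; rewrite !pt1.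
    by have := congr1 (fun p : grid n => nat_of_ord p.2) e; rewrite !pt2.
  have e1 : (i.-1 == i.+1) = false by lia.
  have e2 : (i.-1 == i) = false by lia.
  have e3 : (i.+1 == i) = false by lia.
  have e4 : (j.-1 == j.+1) = false by lia.
  have [b1 b2] : (i.+1 <= n.+1)%N /\ (j.+1 <= n.*2.+1)%N by lia.
  have [b3 b4] := (leq_trans (leq_pred j) (ltnW b2), leq_trans (leq_pred i) (ltnW b1)).
  by rewrite /= !inE !ptn ?e1 ?e2 ?e3 ?e4 ?andbF // ltnW.
move/orientationP: (oD) => oD'.
have outE : #|[set y | (x, y) \in D]| = count (fun y => (x, y) \in D) s.
  apply: card_count => // y xy; apply: adj_s.
  by have := oD' x y; case: adjacent => //; rewrite xy.
have inE' : #|[set y | (y, x) \in D]| = count (fun y => (y, x) \in D) s.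
  apply: card_count => // y xy; apply: adj_s; rewrite adjacentC.
  by have := oD' y x; case: adjacent => //; rewrite xy.
have adjE : {in s, forall y, (y, x) \in D = ~~ ((x, y) \in D)}.
  have vN := vedge_pt eN; have vS := vedge_pt eS; have hE := hedge_pt eE.
  have hW := hedge_pt eW; rewrite prednK // -[i.+1.-1]/i !xE in vN vS hE hW.
  move=> y ys; have := oD' x y; suff -> : adjacent x y by move=> ->; rewrite negbK.
  by move: ys; rewrite !inE adjacentE => /or4P[]/eqP->; rewrite ?vN ?vS ?hE ?hW ?orbT.
rewrite /bulk_ok outE inE' /= !adjE ?inE ?eqxx ?orbT // out_up out_down // out_left // out_right.
rewrite /vertex_weight bx -/i -/j out_up out_down // out_left // out_right.
rewrite /bulk_at /colpar /bulk_weight /label -/i -/j.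
by case: (f _); case: (f _); case: (f _); case: (f _); rewrite /bulk /= ?simp.
Qed.

Lemma left_vertex : Defs.is_left x -> vertex_weight q u D x =
  if f (true, i, i) == f (false, i, i) then sigma (q ^+ 2 * u i ^+ 2) / sigma (q ^+ 2) else 0.
Proof.
move=> lx; have := lx; rewrite /Defs.is_left => /andP[ix /eqP ji].
have bx : is_bulk x = false by rewrite /is_bulk ji; lia.
by rewrite /vertex_weight bx lx /left_weight -/i -/j out_up out_right /j ji.
Qed.

Lemma right_vertex : Defs.is_right x -> vertex_weight q u D x =
  if f (true, i, n.*2.+2 - i)%N == f (false, i, n.*2.+1 - i)%N then 0
  else sigma (q ^+ 2 * (u i)^-1 ^+ 2) / sigma (q ^+ 2).
Proof.
move=> rx; have := rx; rewrite /Defs.is_right => /andP[ix /eqP ji].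
have bx : is_bulk x = false by rewrite /is_bulk ji; lia.
have lx : Defs.is_left x = false by rewrite /Defs.is_left ji; lia.
rewrite /vertex_weight bx lx rx /right_weight -/i -/j out_up out_left; last first.
- by rewrite /is_edge /j ji /i; lia.
- by rewrite /j ji /i; lia.
have -> : j.-1 = (n.*2.+1 - i)%N by rewrite /j ji /i; lia.
by rewrite [j]ji; case: (f _); case: (f _).
Qed.
End Vertex.

Definition left_factor i : F := sigma (q ^+ 2 * u i ^+ 2) / sigma (q ^+ 2).
Definition right_factor i : F := sigma (q ^+ 2 * (u i)^-1 ^+ 2) / sigma (q ^+ 2).

(** The value 1 off the graph extends the product of the weights to the whole rectangle, which
    splits into rows. *)
Definition cell f i j : F :=
  if (1 <= i <= n)%N then
    if (i < j < n.*2.+2 - i)%N then bulk_at f i j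
    else if j == i then
      if f (true, i, i) == f (false, i, i) then left_factor i else 0
    else if (j == n.*2.+2 - i)%N then
      if f (true, i, n.*2.+2 - i)%N == f (false, i, n.*2.+1 - i)%N then 0
      else right_factor i
    else 1
  else 1.

(** The default [(~~ is_vertex x)%:R] is 1 off the graph and 0 at a bulk vertex that violates
    [bulk_ok], so orientations that are not configurations drop out of the sum. *)
Lemma cellE D x : is_orientation D ->
  (if is_vertex x && (is_bulk x ==> bulk_ok D x) then vertex_weight q u D x
   else (~~ is_vertex x)%:R) = cell (dir D) x.1 x.2.
Proof.
move=> oD; rewrite /cell.
have [/andP[/andP[i1 i2] ij]|nb] := boolP (is_bulk x).
  rewrite -(bulk_vertex oD); last by rewrite /is_bulk i1 i2 ij.
  have -> : is_vertex x by rewrite /is_vertex; lia.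
  by rewrite i1 i2 ij; case: (bulk_ok D x).
have [lx|nl] := boolP (Defs.is_left x).
  have := lx; rewrite (left_vertex oD lx) /Defs.is_left => /andP[ix /eqP ji].
  have -> : is_vertex x by rewrite /is_vertex; lia.
  by rewrite ix ji ltnn eqxx.
have [rx|nr] := boolP (Defs.is_right x).
  have := rx; rewrite (right_vertex oD rx) /Defs.is_right => /andP[ix /eqP ji].
  have -> : is_vertex x by rewrite /is_vertex; lia.
  have ij : (n.*2.+2 - x.1 == x.1)%N = false by lia.
  by rewrite ix ji ltnn andbF ij eqxx.
have vw : vertex_weight q u D x = 1.
  by rewrite /vertex_weight (negbTE nb) (negbTE nl) (negbTE nr).
rewrite vw andbT; transitivity (1 : F); first by case: (is_vertex x).
move: nb nl nr; rewrite /is_bulk /Defs.is_left /Defs.is_right.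
case: ifP => // _ nb nl nr; rewrite andTb in nb; rewrite andTb in nl; rewrite andTb in nr.
by rewrite (negbTE nb) (negbTE nl) (negbTE nr).
Qed.

Lemma prod_cell f i : (1 <= i <= n)%N ->
  \prod_(j < n.*2.+2) cell f i j = left_factor i * right_factor i * row_at f i.
Proof.
move=> ni; rewrite -(big_mkord xpredT (cell f i)).
have cellE' j : cell f i j =
    if (i < j < n.*2.+2 - i)%N then bulk_at f i j
    else if j == i then
      if f (true, i, i) == f (false, i, i) then left_factor i else 0
    else if (j == n.*2.+2 - i)%N then
      if f (true, i, n.*2.+2 - i)%N == f (false, i, n.*2.+1 - i)%N then 0
      else right_factor i
    else 1 by rewrite /cell ni.
(* The row is cut into the part before the graph, the left corner, the bulk, the right corner and
   the part behind the graph. *)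
rewrite (@big_cat_nat _ _ _ i) //=; last by lia.
rewrite (@big_cat_nat _ _ _ i.+1 i) //=; last by lia.
rewrite (@big_cat_nat _ _ _ (n.*2.+2 - i) i.+1) //=; [|lia|lia].
rewrite (@big_cat_nat _ _ _ (n.*2.+2 - i).+1 (n.*2.+2 - i)) //=; last by lia.
have cell1 a b : (b <= i \/ n.*2.+2 - i < a)%N -> \prod_(a <= j < b) cell f i j = 1.
  move=> ab; rewrite big_nat big1 // => j ajb; rewrite cellE'.
  by case: ifP => [|_]; [lia|]; case: eqP => [|_]; [lia|]; case: eqP => //; lia.
rewrite !big_nat1 (cell1 0%N i); last by left.
rewrite (cell1 (n.*2.+2 - i).+1); last by right.
have -> : \prod_(i.+1 <= j < n.*2.+2 - i) cell f i j =
    \prod_(j <- iota i.+1 (n - i).*2.+1) bulk_at f i j.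
  have -> : iota i.+1 (n - i).*2.+1 = index_iota i.+1 (n.*2.+2 - i).
    by rewrite /index_iota; congr iota; lia.
  by apply: eq_big_nat => j ij; rewrite cellE' ij.
rewrite !cellE' !ltnn /= andbF eqxx eqxx.
have -> : (n.*2.+2 - i == i)%N = false by lia.
rewrite /row_at mul1r mulr1.
by case: ifP => _; rewrite ?mulr0 ?mul0r //; case: ifP => _;
  rewrite ?mulr0 ?mul0r // mulr1 mulrA mulrAC.
Qed.

Lemma prod_grid_cell f :
  \prod_(x : grid n) cell f x.1 x.2 =
  \prod_(1 <= i < n.+1) (left_factor i * right_factor i) * \prod_(i <- iota 1 n) row_at f i.
Proof.
rewrite -(pair_bigA _ (fun (i : 'I_n.+2) (j : 'I_n.*2.+2) => cell f i j)) /=.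
rewrite -(big_mkord xpredT (fun i => \prod_(j < n.*2.+2) cell f i j)).
rewrite big_ltn // big_nat_recr //= big1 ?mul1r; last by move=> j _; rewrite /cell.
rewrite [X in _ * X]big1 ?mulr1; last by move=> j _; rewrite /cell ltnn andbF.
have -> : iota 1 n = index_iota 1 n.+1 by rewrite /index_iota subn1.
rewrite -big_split /=; apply: eq_big_nat => i ni; exact: prod_cell.
Qed.

Lemma config_sum :
  \sum_(D : {set grid n * grid n} | is_config D) config_weight q u D =
  \prod_(1 <= i < n.+1) (left_factor i * right_factor i) *
  Zvec (map u (iota 1 n)) (u n.+1).
Proof.
rewrite Zvec_asum asum_dir; first last.
- move=> g h gh; apply: eq_big_seq => k; rewrite mem_iota => kn.
  rewrite /row_at !gh; try (rewrite /is_edge; lia).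
  case: ifP => // _; congr (_ * _); apply: eq_big_seq => m; rewrite mem_iota => km.
  by rewrite /bulk_at !gh // /is_edge; lia.
- by move=> [[b i] j]; rewrite mem_tri_edges1 => /andP[].
- exact: uniq_tri_edges.
rewrite mulr_sumr [LHS]big_mkcond [RHS]big_mkcond; apply: eq_bigr => D _.
rewrite /agree /is_config; case oD: (is_orientation D); last by [].
rewrite !andTb andbC.
(* The top edges are those in [edges] that [tri_edges 1 n] leaves out. *)
have -> : [forall x, forall y, vedge x y && (x.1 == 0 :> nat) ==> ((y, x) \in D)] =
   all (fun e => (e \in tri_edges 1 n) || (dir D e == true)) edges.
  apply/forallP/allP => [h [[b i] j]|h x].
    rewrite mem_edges mem_tri_edges1 => e; rewrite e eqb_id.
    case: b e => e; last by [].
    have [i1|i1] := eqVneq i 1%N; last by apply/orP; left; move: e => /=; lia.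
    move: e; rewrite i1 => e; apply/orP; right.
    have /forallP/(_ (pt n 1 j))/implyP := h (pt n 0 j); apply.
    by rewrite (vedge_pt e) pt1.
  apply/forallP => y; apply/implyP => /andP[xy /eqP x0].
  have y1 : y.1 = 1%N :> nat by case/and4P: (xy) => _ _ /eqP; rewrite x0.
  have e : is_edge (true, nat_of_ord y.1, nat_of_ord y.2).
    by move: xy; rewrite vedgeE => /andP[].
  have := h _ (etrans (mem_edges _) e).
  by rewrite mem_tri_edges1 eqb_id (dir_up _ xy) implyTb y1 ltnn andbF.
case: (all _ _); last by [].
rewrite andTb -prod_grid_cell.
have -> : \prod_(x : grid n) cell (dir D) x.1 x.2 =
   \prod_x (if is_vertex x && (is_bulk x ==> bulk_ok D x) then vertex_weight q u D x
   else (~~ is_vertex x)%:R) by apply: eq_bigr => x _; rewrite cellE.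
case: ifP => [/forallP ok|/negbT].
  rewrite /config_weight big_mkcond; apply: eq_bigr => x _.
  by have -> := ok x; rewrite andbT; case: (is_vertex x).
rewrite negb_forall => /existsP[x]; rewrite negb_imply => /andP[bx nok].
have xv : is_vertex x by move: bx; rewrite /is_bulk /is_vertex; lia.
by rewrite (bigD1 x) //= xv bx /bulk_ok (negbTE nok) /= mul0r.
Qed.

Lemma Z_OOSASM_Zvec :
    (forall i, (1 <= i <= n)%N -> sigma (q ^+ 2 * u i ^+ 2) != 0) ->
    (forall i, (1 <= i <= n)%N -> sigma (q ^+ 2 * (u i)^-1 ^+ 2) != 0) ->
    sigma (q ^+ 2) != 0 ->
  Z_OOSASM n q u = Zvec (map u (iota 1 n)) (u n.+1).
Proof.
move=> l0 r0 s20; rewrite /Z_OOSASM config_sum mulrAC.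
have -> : \prod_(1 <= i < n.+1) (left_factor i * right_factor i) =
   \prod_(1 <= i < n.+1) (sigma (q ^+ 2 * u i ^+ 2) * sigma (q ^+ 2 * (u i)^-1 ^+ 2)
       / sigma (q ^+ 2) ^+ 2).
  by apply: eq_bigr => i _; rewrite /left_factor /right_factor mulrACA -invfM expr2.
rewrite mulfV ?mul1r //; rewrite big_nat prodf_seq_neq0; apply/allP => i _ /=.
apply/implyP => ni; apply: mulf_neq0; last by rewrite invr_eq0 expf_neq0.
by apply: mulf_neq0; [apply: l0 | apply: r0].
Qed.

End VertexModel.

(** * The theorem *)

Section RightHandSide.
Variables (F : fieldType) (q : F) (u : nat -> F).

(** The start [a] is free because the induction removes the first index. *)
Lemma prod_pref a N :
  \prod_(a <= i < a + N) \prod_(i.+1 <= j < a + N)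
    (gfac q (u i) (u j) / sigma (u i * (u j)^-1)) = pref q (map u (iota a N)).
Proof.
elim: N a => [|N IH] a; first by rewrite addn0 big_geq.
rewrite -addSnnS big_ltn; last by lia.
rewrite IH /= big_map; congr (_ * _).
by rewrite /index_iota addKn.
Qed.

Lemma prefactor_pref N : prefactor N q u = pref q (map u (iota 1 N)).
Proof. exact: (prod_pref 1 N). Qed.

Lemma Pf_pf m (a : nat -> nat -> F) : Pf m a = pf m (fun i j => a i.+1 j.+1).
Proof. by []. Qed.

Lemma nth_indices N (e : seq (option F)) i : (i < N)%N ->
  nth None (map Some (map u (iota 1 N)) ++ e) i = Some (u i.+1).
Proof.
move=> iN; rewrite nth_cat !size_map size_iota iN.
rewrite (nth_map (0 : F)) ?size_map ?size_iota //.
by rewrite (nth_map 0%N) ?size_iota // nth_iota.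
Qed.

Lemma P_list m : P m q u = Plist q (map u (iota 1 m.*2)).
Proof.
rewrite /P /Plist /rhs /pf_list prefactor_pref size_map size_iota doubleK subn1.
rewrite mulrA; congr (_ * _); rewrite /pfl size_cat !size_map size_iota addn0 doubleK.
rewrite Pf_pf; apply: eq_pf => i j /andP[ij jm]; have im := ltn_trans ij jm.
by rewrite !nth_indices // /entry /kappaP mul1r.
Qed.

Lemma Q_list m : (0 < m)%N -> generic q (map u (iota 1 (m.*2 - 1))) -> q != 0 ->
  Q m q u = Qlist q (map u (iota 1 (m.*2 - 1))).
Proof.
move=> m0 gus q0; rewrite /Q /Qlist /rhs /pf_list prefactor_pref size_map size_iota.
have -> : (m.*2 - 1)./2 = (m - 1)%N by lia.
rewrite mulrA; congr (_ * _); rewrite /pfl size_cat !size_map size_iota /=.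
have -> : (m.*2 - 1 + 1)./2 = m by lia.
rewrite Pf_pf; apply: eq_pf => i j /andP[ij jm].
have im : (i < m.*2 - 1)%N by lia.
rewrite (nth_indices _ im); have [jm'|jm'] := ltnP j.+1 m.*2; last first.
  (* The column 2m of Q is the entry [None] at the end of the list. *)
  have -> : j = (m.*2 - 1)%N by lia.
  by rewrite nth_cat !size_map size_iota ltnn subnn.
have jm1 : (j < m.*2 - 1)%N by lia.
rewrite (nth_indices _ jm1).
have mem_us k : (k < m.*2 - 1)%N -> u k.+1 \in map u (iota 1 (m.*2 - 1)).
  by move=> km; apply: map_f; rewrite mem_iota; lia.
have := generic_gfac q0 gus (mem_us _ im) (mem_us _ jm1).
rewrite /= /gfac mulf_eq0 negb_or => /andP[g1 g2]; rewrite /kappaQ.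
by field; rewrite g1 g2.
Qed.

Lemma Z_OOSASM_generic n : [pchar F] =i pred0 ->
    q != 0 -> q ^+ 8 != 1 -> generic q (map u (iota 1 n.+1)) ->
  Z_OOSASM n q u = P (uphalf n) q u * Q (uphalf n.+1) q u.
Proof.
move=> charF q0 q8 gen1.
have gen m : (m <= n.+1)%N -> generic q (map u (iota 1 m)).
  move=> mn; apply: generic_subseq gen1; apply: map_subseq.
  by rewrite -(subnKC mn) iotaD prefix_subseq.
have mem_u i : (1 <= i <= n)%N -> u i \in map u (iota 1 n).
  by move=> ni; apply: map_f; rewrite mem_iota; lia.
have u0 i : (1 <= i <= n)%N -> u i != 0.
  by move=> /mem_u; apply: generic_neq0 (gen n (leqnSn n)) _.
have s40 : sigma (q ^+ 4) != 0 by rewrite sigma_eq0 ?expf_neq0 // -exprM.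
have rconsE : rcons (map u (iota 1 n)) (u n.+1) = map u (iota 1 n.+1).
  by rewrite -map_rcons -cats1 -[in RHS](addn1 n) iotaD.
rewrite Z_OOSASM_Zvec //; first last.
- rewrite sigma_eq0 ?expf_neq0 //; apply: contra q8 => /eqP q4.
  have -> : q ^+ 8 = ((q ^+ 2) ^+ 2) ^+ 2 by ring.
  by rewrite q4 expr1n.
- move=> i ni; rewrite sigma_eq0; last by rewrite ?(mulf_neq0, expf_neq0, invr_eq0, u0).
  have := generic_mulV (gen n (leqnSn n)) (mem_u _ ni) (mem_u _ ni).
  apply: contra => /eqP h; apply/eqP.
  transitivity ((u i * u i) ^+ 2 * (q ^+ 2 * (u i)^-1 ^+ 2) ^+ 2); first by rewrite h mulr1.
  by field; rewrite u0.
- move=> i ni; rewrite sigma_eq0; last by rewrite ?(mulf_neq0, expf_neq0, u0).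
  have := generic_mul (gen n (leqnSn n)) (mem_u _ ni) (mem_u _ ni).
  by apply: contra => /eqP h; apply/eqP; rewrite -h; ring.
rewrite Zvec_list //; last by rewrite rconsE.
rewrite rconsE size_map size_iota P_list Q_list //; last by apply: gen; lia.
case: ifP => odd_n.
  have -> : (uphalf n).*2 = n.+1 by lia.
  by have -> : ((uphalf n.+1).*2 - 1 = n)%N by lia.
have -> : (uphalf n).*2 = n by lia.
by have -> : ((uphalf n.+1).*2 - 1 = n.+1)%N by lia.
Qed.
End RightHandSide.

(** * Genericity of the indeterminates *)

Section Indeterminates.
Variables (K : fieldType) (n : nat).
Let q := indet K n 0.
Let u := fun i => indet K n i.

Lemma tofrac_neq0 (p : {mpoly K[n.+2]}) v : p.@[v] != 0 -> tofrac p != 0.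
Proof. by rewrite tofrac_eq0; apply: contra => /eqP ->; rewrite meval0. Qed.

Lemma tofrac_neq (p r : {mpoly K[n.+2]}) v : p.@[v] != r.@[v] -> tofrac p != tofrac r.
Proof. by rewrite tofrac_eq; apply: contra => /eqP ->. Qed.

Let X k : {mpoly K[n.+2]} := 'X_(inord k).

(* The genericity conditions are inequalities of monomials, and evaluation at
   one of these 0/1 points separates the two sides. *)
Let pt0 (k : nat) : 'I_n.+2 -> K := fun i => (i != inord k)%:R.

Lemma inord_neq i j : (i < n.+2)%N -> (j < n.+2)%N -> i != j -> inord i != inord j :> 'I_n.+2.
Proof. by move=> li lj ij; rewrite -val_eqE /= !inordK. Qed.

Lemma meval_pt0 i k : (i < n.+2)%N -> (k < n.+2)%N -> (X i).@[pt0 k] = (i != k)%:R.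
Proof.
move=> li lk; rewrite mevalXU /pt0; have [->|ik] := eqVneq i k; first by rewrite eqxx.
by rewrite inord_neq.
Qed.

Lemma indet_neq0 i : (i < n.+2)%N -> indet K n i != 0.
Proof. by move=> li; apply: (@tofrac_neq0 _ (fun=> 1)); rewrite mevalXU oner_eq0. Qed.

Lemma q8_neq1 : q ^+ 8 != 1.
Proof.
rewrite /q /indet -tofracXn -tofrac1; apply: (@tofrac_neq _ _ (pt0 0)).
by rewrite rmorphXn /= meval_pt0 // expr0n meval1 eq_sym oner_eq0.
Qed.

Lemma generic_indet m : (m <= n.+1)%N -> generic q (map u (iota 1 m)).
Proof.
move=> le_m; have mem_i x : x \in map u (iota 1 m) ->
    exists2 i, (0 < i < n.+2)%N & x = tofrac (X i).
  by case/mapP => i; rewrite mem_iota => im ->; exists i => //; lia.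
have nz i : (0 < i)%N -> (i != 0)%N by lia.
split.
- by move=> x /mem_i[i /andP[_ li] ->]; apply: indet_neq0.
- rewrite -map_comp map_inj_in_uniq ?iota_uniq // => i j.
  rewrite !mem_iota /= => im jm /eqP; apply: contraTeq => ij.
  rewrite /u /indet -!tofracXn; apply: (@tofrac_neq _ _ (pt0 j)).
  rewrite !rmorphXn /= !meval_pt0; try lia.
  by rewrite ij eqxx expr1n expr0n oner_eq0.
- move=> x y /mem_i[i /andP[i0 li] ->] /mem_i[j /andP[j0 lj] ->].
  rewrite /q /indet -tofracM -!tofracXn -tofracM -tofrac1.
  apply: (@tofrac_neq _ _ (pt0 0)).
  by rewrite rmorphM rmorphXn /= meval_pt0 // expr0n mul0r meval1 eq_sym oner_eq0.
- move=> x y /mem_i[i /andP[i0 li] ->] /mem_i[j /andP[j0 lj] ->].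
  rewrite /q /indet -tofracM -!tofracXn; apply: (@tofrac_neq _ _ (pt0 0)).
  rewrite !rmorphXn rmorphM /= !meval_pt0 // (nz _ i0) (nz _ j0) expr0n mul1r expr1n.
  by rewrite oner_eq0.
move=> x y /mem_i[i /andP[i0 li] ->] /mem_i[j /andP[j0 lj] ->].
rewrite /q /indet -!tofracXn -tofracM; apply: (@tofrac_neq _ _ (pt0 0)).
rewrite [Z in _ != Z]rmorphM !rmorphXn /= !meval_pt0 // (nz _ i0) (nz _ j0) expr0n mul0r expr1n.
by rewrite oner_eq0.
Qed.

Lemma pchar_indet : [pchar K] =i pred0 -> [pchar {fraction {mpoly K[n.+2]}}] =i pred0.
Proof.
move=> /GRing.pcharf0P charK0; apply/GRing.pcharf0P => k.
have [->|k0] := eqVneq k 0%N; first by rewrite eqxx.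
apply/negbTE; rewrite -tofrac1 -tofracMn; apply: (@tofrac_neq0 _ (fun=> 0)).
by rewrite rmorph_nat charK0.
Qed.
End Indeterminates.

Theorem theorem7p1 (K : fieldType) (charK0 : [pchar K] =i pred0)
    (n : nat) (n_gt0 : (0 < n)%N) :
  let q := indet K n 0 in
  let u := fun i : nat => indet K n i in
  Z_OOSASM n q u = P (uphalf n) q u * Q (uphalf n.+1) q u.
Proof.
apply: Z_OOSASM_generic.
- exact: pchar_indet.
- exact: indet_neq0.
- exact: q8_neq1.
exact: generic_indet.
Qed.
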